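(* Let $\mathcal{D}$ be a distribution over samples $(\bm{x},y)$ and $\ell(\bm{w},\bm{x},y)$ a loss differentiable in $\bm{w}\in\mathbb{R}^d$. Suppose there is a function $G(\bm{x},y)\ge0$ with $\|\nabla_{\bm{w}}\ell(\bm{w},\bm{x},y)\|\le G(\bm{x},y)$ for all $\bm{w}\in\mathbb{R}^d$ and all $(\bm{x},y)$ in the support of $\mathcal{D}$, and that for some $k>1$ and $G>0$, $\left(\mathbb{E}_{(\bm{x},y)\sim\mathcal{D}}[G(\bm{x},y)^k]\right)^{1/k}\le G$. Let $\mathcal{Z}=\{(\bm{x}_i,y_i)\}_{i=1}^n$ be i.i.d. from $\mathcal{D}$, $f_i(\bm{w})=\ell(\bm{w},\bm{x}_i,y_i)$, $f=\frac1n\sum_if_i$, suppose $f$ is convex with a minimizer $\bm{w}^*\in\arg\min_{\bm{w}\in\mathbb{R}^d}f(\bm{w})$, and take $\mathcal{W}=\mathbb{R}^d$. Fix $\gamma\in(0,1)$, $C>0$, $T\ge1$, and run DP-SGD with $\tau=\frac{G}{\gamma^{1/k}}\left(\frac1T+\varphi^2\right)^{-\frac1{k+1}}$, $\eta_t=\eta=\frac{C}{T\tau}\left(\frac1T+\varphi^2\right)^{-\frac12}$ for all $t<T$, and $\sigma_n^2=\frac{\nu T\log(1/\delta)\tau^2}{n^2\varepsilon^2}$. Then with probability at least $1-\gamma$ over the random dataset $\mathcal{Z}$, $$\mathrm{OR}(T)\le\frac{G}{\gamma^{1/k}}\left\{\frac12\left(\frac{\|\bm{w}_0-\bm{w}^*\|^2}{C}+4C\right)\left(\frac1T+\varphi^2\right)^{\frac12(1-\frac2{k+1})}+(\|\bm{w}_0-\bm{w}^*\|+C)\left(\frac1T+\varphi^2\right)^{1-\frac2{k+1}}\right\}.$$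 In particular, for $T=\frac1{\varphi^2}$, $$\mathrm{OR}(T)\le\frac{G}{\gamma^{1/k}}\left\{\frac{1}{2^{\frac12+\frac1{k+1}}}\left(\frac{\|\bm{w}_0-\bm{w}^*\|^2}{C}+4C\right)\varphi^{1-\frac2{k+1}}+2^{1-\frac2{k+1}}(\|\bm{w}_0-\bm{w}^*\|+C)\varphi^{2(1-\frac2{k+1})}\right\}.$$
   Context: For $\bm{z}\in\mathbb{R}^d$ and $c>0$, $\mathrm{clip}(\bm{z},c)=\bm{z}\min(1,c/\|\bm{z}\|)$ ($\|\cdot\|$ Euclidean). DP-SGD (unconstrained): given $\bm{w}_0\in\mathbb{R}^d$, $T$, step sizes $\eta_t$, a parameter $b\ge1$, clip norm $\tau$, noise variance $\sigma_n^2$: for $t=0,\dots,T-1$, form $\mathcal{S}_t\subseteq[n]$ by including each index independently with probability $b/n$; $\bm{g}_t=\frac1b\sum_{i\in\mathcal{S}_t}\mathrm{clip}(\nabla f_i(\bm{w}_t),\tau)+\bm{\zeta}_t$, $\bm{\zeta}_t\sim\mathcal{N}(\bm{0},\sigma_n^2I_d)$ independent; $\bm{w}_{t+1}=\bm{w}_t-\eta_t\bm{g}_t$. Output $\bm{w}_{\mathrm{priv}}=\bm{w}_{\widehat t}$, $\widehat t$ uniform on $\{0,\dots,T-1\}$. Here $\varepsilon>0$, $\delta\in(0,1)$, $\nu>0$ a fixed absolute constant, $\varphi=\frac{\sqrt{\nu d\log(1/\delta)}}{n\varepsilon}$. The optimization risk is $\mathrm{OR}(T)=\mathbb{E}[f(\bm{w}_{\mathrm{priv}})]-f(\bm{w}^*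 )$, the expectation over the algorithm's randomness conditional on $\mathcal{Z}$. *)

(* Defs.v *)
From HB Require Import structures.
From mathcomp Require Import all_boot all_order all_algebra.
From mathcomp Require Import all_classical all_reals all_analysis.
Set Implicit Arguments. Unset Strict Implicit. Unset Printing Implicit Defensive.
Import Order.TTheory GRing.Theory Num.Theory.
Import numFieldNormedType.Exports.
Local Open Scope classical_set_scope.
Local Open Scope ring_scope.

Definition enorm {R : realType} {d : nat} (z : 'rV[R]_d) : R :=
  Num.sqrt (\sum_(j < d) z 0 j ^+ 2).

Definition clip {R : realType} {d : nat} (z : 'rV[R]_d) (c : R) : 'rV[R]_d :=
  Num.min 1 (c / enorm z) *: z.

Definition grad {R : realType} {d : nat} (h : 'rV[R]_d -> R) (w : 'rV[R]_d)
  : 'rV[R]_d := \row_(j < d) ('D_(delta_mx 0 j) h w).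

Definition convex_fun {R : realType} {d : nat} (h : 'rV[R]_d -> R) : Prop :=
  forall (x y : 'rV[R]_d) (a : R), 0 <= a <= 1 ->
    h (a *: x + (1 - a) *: y) <= a * h x + (1 - a) * h y.

Definition mutual_indep {dO dT : measure_display} {R : realType}
  {Om : measurableType dO} {T : measurableType dT} (P : probability Om R)
  {I : finType} (X : I -> Om -> T) : Prop :=
  (forall i, measurable_fun setT (X i)) /\
  forall B : I -> set T, (forall i, measurable (B i)) ->
    P (\bigcap_(i in [set: I]) (X i @^-1` B i)) =
    (\prod_(i : I) P (X i @^-1` B i))%E.

(** DP-SGD iterates (unconstrained), for a given realization of the
    randomness: [incl t i] says whether index i is in S_t, [zeta t] is the
    noise vector at step t, [g i w] = grad f_i (w). *)
Fixpoint dpsgd_iter {R : realType} {d n : nat} (g : 'I_n -> 'rV[R]_d -> 'rV[R]_d)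
  (w0 : 'rV[R]_d) (eta : nat -> R) (b tau : R) (incl : nat -> 'I_n -> bool)
  (zeta : nat -> 'rV[R]_d) (t : nat) : 'rV[R]_d :=
  match t with
  | 0 => w0
  | t'.+1 =>
      let w := dpsgd_iter g w0 eta b tau incl zeta t' in
      w - eta t' *: (b^-1 *: (\sum_(i < n | incl t' i) clip (g i w) tau) + zeta t')
  end.

(* Main.v *)
(** Fix the dataset, let v be the minimizer of f and u_t = w_t - v.  Convexity
    gives f(w_t) - f(v) <= <grad f(w_t), u_t>.  Replacing the gradient by the
    mean of the clipped gradients costs at most B |u_t|, where B bounds the
    clipping bias, and given the past that mean is the expectation of the
    DP-SGD direction, whose second moment is at most V = 2 tau^2 + d sigma_n^2.
    Hence
      E|u_{t+1}|^2 <= E|u_t|^2 - 2 eta (E[f(w_t) - f(v)] - B E|u_t|) + eta^2 V.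
    Dropping the function gap first yields
      E|u_t| <= eta B t + sqrt (|u_0|^2 + eta^2 V t),
    and summing the recursion with this distance bound yields the risk bound.

    By Markov's inequality, with probability at least 1 - gamma the empirical
    k-th moment of the gradient bounds is at most G^k / gamma.  Then B can be
    taken at most G' = G / gamma^(1/k) and at most G'^k tau^(1-k), so that
    B^2 <= tau^2 (1/T + phi^2); this absorbs the drift eta B t for small and
    large 1/T + phi^2 alike.

    Instead of conditional expectations, the independence enters through a
    product rule: if Y is measurable for the sigma-algebra generated by all
    sources of randomness except X, then E[Y X] = E[Y] E[X]. *)

Require Import Defs.
From HB Require Import structures.
From mathcomp Require Import all_boot all_order all_algebra.
From mathcomp Require Import all_classical all_reals all_analysis.
From mathcomp Require Import measurable_realfun ring lra.
Import Order.TTheory GRing.Theory Num.Theory.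
Import numFieldNormedType.Exports.
Local Open Scope classical_set_scope.
Local Open Scope ring_scope.
Set Implicit Arguments.
Unset Strict Implicit.
Unset Printing Implicit Defensive.

(** * Vectors, clipping and gradients *)

Definition dotv {R : realType} {d : nat} (u v : 'rV[R]_d) : R :=
  \sum_(j < d) u 0 j * v 0 j.

Lemma dotvDl (R : realType) (d : nat) (u v w : 'rV[R]_d) :
  dotv (u + v) w = dotv u w + dotv v w.
Proof. by rewrite /dotv -big_split; apply: eq_bigr => j _; rewrite mxE mulrDl. Qed.

Lemma dotvZl (R : realType) (d : nat) a (u w : 'rV[R]_d) :
  dotv (a *: u) w = a * dotv u w.
Proof. by rewrite /dotv mulr_sumr; apply: eq_bigr => j _; rewrite mxE mulrA. Qed.

Lemma dotvC (R : realType) (d : nat) (u w : 'rV[R]_d) : dotv u w = dotv w u.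
Proof. by apply: eq_bigr => j _; rewrite mulrC. Qed.

Lemma dotvBl (R : realType) (d : nat) (u v w : 'rV[R]_d) :
  dotv (u - v) w = dotv u w - dotv v w.
Proof. by rewrite -scaleN1r dotvDl dotvZl mulN1r. Qed.

Lemma dotvZr (R : realType) (d : nat) a (u w : 'rV[R]_d) :
  dotv w (a *: u) = a * dotv w u.
Proof. by rewrite dotvC dotvZl dotvC. Qed.

Lemma dotvBr (R : realType) (d : nat) (u v w : 'rV[R]_d) :
  dotv w (u - v) = dotv w u - dotv w v.
Proof. by rewrite dotvC dotvBl !(dotvC _ w). Qed.

Lemma enorm_ge0 (R : realType) (d : nat) (u : 'rV[R]_d) : 0 <= enorm u.
Proof. exact: sqrtr_ge0. Qed.

Lemma enorm_sqr (R : realType) (d : nat) (u : 'rV[R]_d) : enorm u ^+ 2 = dotv u u.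
Proof.
rewrite /enorm sqr_sqrtr; last by apply: sumr_ge0 => j _; exact: sqr_ge0.
by apply: eq_bigr => j _; rewrite expr2.
Qed.

Lemma enormZ (R : realType) (d : nat) a (u : 'rV[R]_d) :
  enorm (a *: u) = `|a| * enorm u.
Proof.
rewrite -sqrtr_sqr /enorm -sqrtrM ?sqr_ge0//; congr Num.sqrt.
by rewrite mulr_sumr; apply: eq_bigr => j _; rewrite mxE exprMn.
Qed.

Lemma enorm0_eq0 (R : realType) (d : nat) (u : 'rV[R]_d) : enorm u = 0 -> u = 0.
Proof.
move=> u0; have : dotv u u == 0 by rewrite -enorm_sqr u0 expr0n.
rewrite psumr_eq0; last by move=> j _; rewrite -expr2 sqr_ge0.
move=> /allP h; apply/rowP => j; rewrite mxE; apply/eqP.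
by have := h j (mem_index_enum _); rewrite mulf_eq0 orbb.
Qed.

(** Expanding the square norm of [b *: u - a *: v], with [a = enorm u] and [b = enorm v], gives
    [2 a b (a b - dotv u v) >= 0]. Dividing by [a b] needs both norms nonzero, so vanishing norms
    are treated first. *)
Lemma le_dotv_enorm (R : realType) (d : nat) (u v : 'rV[R]_d) :
  dotv u v <= enorm u * enorm v.
Proof.
have [u0|u0] := eqVneq (enorm u) 0.
  rewrite u0 mul0r (enorm0_eq0 u0) /dotv big1// => j _.
  by rewrite mxE mul0r.
have [v0|v0] := eqVneq (enorm v) 0.
  rewrite v0 mulr0 (enorm0_eq0 v0) /dotv big1// => j _.
  by rewrite mxE mulr0.
set a := enorm u; set b := enorm v.
have ab0 : 0 < a * b by rewrite mulr_gt0// lt_def enorm_ge0 andbT.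
have := sqr_ge0 (enorm (b *: u - a *: v)).
rewrite enorm_sqr dotvBl !dotvBr !dotvZl !dotvZr.
rewrite -!enorm_sqr (dotvC v u) -/a -/b.
move=> h; have {}h : 0 <= 2 * (a * b) * (a * b - dotv u v).
  by apply: le_trans h _; rewrite le_eqVlt; apply/orP; left; apply/eqP; ring.
by move: h; rewrite pmulr_rge0 ?subr_ge0// mulr_gt0.
Qed.

Lemma enorm_clip (R : realType) (d : nat) (z : 'rV[R]_d) (c : R) : 0 < c ->
  enorm (clip z c) = Num.min (enorm z) c.
Proof.
move=> c0; rewrite /clip enormZ ger0_norm; last first.
  by rewrite le_min ler01 divr_ge0 ?enorm_ge0// ltW.
(* At norm 0 the scaling factor contains [c / 0 = 0], but it multiplies a zero norm, so both sides
   vanish. *)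
have [z0|z0] := eqVneq (enorm z) 0.
  by rewrite z0 mulr0 minEle (ltW c0).
have zp : 0 < enorm z by rewrite lt_def z0 enorm_ge0.
by rewrite minr_pMl ?ltW// mul1r divfK.
Qed.

Lemma enorm_sub_clip (R : realType) (d : nat) (z : 'rV[R]_d) (c : R) : 0 < c ->
  enorm (z - clip z c) = Num.max 0 (enorm z - c).
Proof.
move=> c0; rewrite /clip -{1}[z]scale1r -scalerBl enormZ ger0_norm; last first.
  by rewrite subr_ge0 ge_min lexx.
have [z0|z0] := eqVneq (enorm z) 0.
  by rewrite z0 mulr0 sub0r max_l// oppr_le0 ltW.
have zp : 0 < enorm z by rewrite lt_def z0 enorm_ge0.
rewrite mulrBl mul1r minr_pMl ?ltW// mul1r divfK//.
have [h|h] := leP (enorm z) c; first by rewrite subrr max_l// subr_le0.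
by rewrite max_r// subr_ge0 ltW.
Qed.

Lemma enorm_sub_clip_le (R : realType) (d : nat) (z : 'rV[R]_d) (c : R) : 0 < c ->
  enorm (z - clip z c) <= enorm z.
Proof.
by move=> c0; rewrite enorm_sub_clip// ge_max enorm_ge0 gerBl ltW.
Qed.

(* Above the threshold the norm itself is at most [g * (g / c) `^ (k - 1)]. *)
Lemma enorm_sub_clip_powR (R : realType) (d : nat) (z : 'rV[R]_d) (c g k : R) :
  0 < c -> 1 < k -> enorm z <= g ->
  enorm (z - clip z c) <= g `^ k * c `^ (1 - k).
Proof.
move=> c0 k1 zg; rewrite enorm_sub_clip//.
have [zc|zc] := leP (enorm z) c.
  by rewrite max_l ?subr_le0// mulr_ge0 ?powR_ge0.
rewrite max_r ?subr_ge0 ?(ltW zc)//.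
have g0 : 0 < g by rewrite (lt_trans c0)// (lt_le_trans zc).
apply: (@le_trans _ _ g); first by rewrite (le_trans _ zg)// gerBl ltW.
have -> : c `^ (1 - k) = (c `^ (k - 1))^-1 by rewrite -powRN opprB.
have -> : g `^ k = g * g `^ (k - 1).
  rewrite -{2}(powRr1 (ltW g0)) -powRD ?subrKC//.
  by apply/implyP => _; rewrite gt_eqF.
rewrite ler_pdivlMr ?powR_gt0// ler_wpM2l ?(ltW g0)//.
by rewrite ge0_ler_powR ?nnegrE ?subr_ge0 ?(ltW k1) ?(ltW c0) ?(ltW g0)// (le_trans (ltW zc)).
Qed.

(** The differential is linear, hence determined by its values on the basis vectors, which are the
    entries of [grad]. *)
Lemma derive_dotv_grad (R : realType) (d : nat) (h : 'rV[R]_d -> R) w v :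
  differentiable h w -> 'D_v h w = dotv (grad h w) v.
Proof.
move=> dh; rewrite deriveE// {1}(row_sum_delta v) linear_sum /dotv.
by apply: eq_bigr => j _; rewrite linearZ mxE deriveE//= mulrC.
Qed.

(** By convexity every difference quotient from [w] towards [v] with step [a] in []0, 1]] is at most
    [h v - h w]; the directional derivative is their limit. *)
Lemma convex_le_dotv_grad (R : realType) (d : nat) (h : 'rV[R]_d -> R) w v :
  convex_fun h -> differentiable h w -> h w - h v <= dotv (grad h w) (w - v).
Proof.
move=> ch dh.
have -> : dotv (grad h w) (w - v) = - dotv (grad h w) (v - w).
  by rewrite -mulN1r -dotvZr scaleN1r opprB.
rewrite -derive_dotv_grad// lerNr opprB.
(* Convexity controls only positive steps, so the limit is restricted to the right of 0. *)
have c1 := cvg_dnbhs_at_right (@diff_derivable _ _ _ h w (v - w) dh).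
rewrite /derive -(cvg_lim _ c1)//; apply: limr_le; first exact: cvgP c1.
near=> a.
have a0 : 0 < a by [].
have a1 : a <= 1 by near: a; exact: nbhs_right_le.
rewrite /= [_ *: _]mulrC ler_pdivrMr// lerBlDr.
have -> : a *: (v - w) + w = a *: v + (1 - a) *: w.
  by rewrite scalerBr scalerBl scale1r addrAC -addrA.
apply: (le_trans (ch _ _ _ _)); first by rewrite (ltW a0).
by rewrite le_eqVlt; apply/orP; left; apply/eqP; ring.
Unshelve. all: by end_near.
Qed.

(** Measurability of [Y] is given coordinate by coordinate, so the event [c < h (Y x)] is written as
    a countable union of events that [Y x] lies in a rational cube. *)
Lemma measurable_continuous_rV (R : realType) (dT : measure_display)
    (T : measurableType dT) (d : nat) (h : 'rV[R]_d -> R) (Y : T -> 'rV[R]_d) :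
  continuous h -> (forall j, measurable_fun setT (fun x => Y x 0 j)) ->
  measurable_fun setT (fun x => h (Y x)).
Proof.
move=> ch mY.
apply: (measurability _ (RGenOInfty.measurableE R)) => _ [_ [c ->] <-].
rewrite setTI.
(* A pair [p] encodes the cube with rational centre [p.1] and half-side [1 / (p.2 + 1)]. It is good
   if [h] exceeds [c] on the whole cube; [F] replaces the other cubes by the empty set. *)
pose good (p : 'rV[rat]_d * nat) := forall z : 'rV[R]_d,
  (forall j, `|z 0 j - ratr (p.1 0 j)| < p.2.+1%:R^-1) -> c < h z.
pose F p := if `[< good p >] then
  \bigcap_(j in [set: 'I_d]) [set x | `|Y x 0 j - ratr (p.1 0 j)| < p.2.+1%:R^-1]
  else set0.
have mF p : measurable (F p).
  rewrite /F; case: ifP => // _; apply: fin_bigcap_measurable => [|j _]; first exact: finite_finset.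
  have mf : measurable_fun setT (fun x => `|Y x 0 j - ratr (p.1 0 j)|).
    by apply: measurableT_comp => //; apply: measurable_funB.
  rewrite -[X in measurable X]setTI.
  have -> : [set x | `|Y x 0 j - ratr (p.1 0 j)| < p.2.+1%:R^-1] =
    (fun x => `|Y x 0 j - ratr (p.1 0 j)|) @^-1` `]-oo, p.2.+1%:R^-1[.
    by apply/seteqP; split => x /=; rewrite in_itv.
  exact: mf.
have -> : (fun x => h (Y x)) @^-1` `]c, +oo[ = \bigcup_p F p; last first.
  by apply: countable_bigcupT_measurable => //; exact: countableP.
apply/seteqP; split=> x /=; last first.
  move=> [p _]; rewrite /F; case: ifP => // /asboolP gp.
  move=> Fx; rewrite in_itv/= andbT; apply: gp => j.
  exact: Fx.
rewrite in_itv/= andbT => cx.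
have : nbhs (h (Y x)) [set y | c < y].
  by apply: open_nbhs_nbhs; split => //; exact: open_gt.
move=> /(ch (Y x)) /nbhs_ballP[e /= e0 he].
(* With half-side below [e / 2] and a rational centre within one half-side of [Y x], the cube
   contains [Y x] and stays inside the [e]-ball around it. *)
have [m _ hm] : exists2 m : nat, True & m.+1%:R^-1 < e / 2.
  have e20 : 0 < e / 2 by rewrite divr_gt0.
  have [m _ hm] := near_infty_natSinv_lt (PosNum e20).
  by exists m => //; exact: (hm m (leqnn m)).
have hq j : {q : rat | `|Y x 0 j - ratr q| < m.+1%:R^-1}.
  apply: cid; have [|q] := @rat_in_itvoo _ (Y x 0 j - m.+1%:R^-1) (Y x 0 j + m.+1%:R^-1).
    by rewrite ltrD2l gtrN// invr_gt0.
  rewrite in_itv/= => /andP[]; set r := m.+1%:R^-1 => q1 q2; exists q.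
  by rewrite ltr_norml; apply/andP; split; lra.
exists (\row_j sval (hq j), m) => //; rewrite /F ifT.
  move=> j _ /=; rewrite mxE.
  by case: (hq j).
apply/asboolP => z hz; apply: he; split => // i j; rewrite (ord1 i) /ball/=.
have := hz j; rewrite /= mxE; case: (hq j) => q /= hq' hz'.
apply: (le_lt_trans (ler_distD (ratr q) _ _)); rewrite [e]splitr.
apply: ltrD; first exact: lt_trans hq' hm.
by rewrite distrC; exact: lt_trans hz' hm.
Qed.

(** The derivative is the pointwise limit of difference quotients with steps [1 / (m + 1)], each
    measurable because [h] is continuous. *)
Lemma measurable_derive_rV (R : realType) (dT : measure_display)
    (T : measurableType dT) (d : nat) (h : 'rV[R]_d -> R) (Y : T -> 'rV[R]_d) v :
  (forall w, differentiable h w) ->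
  (forall j, measurable_fun setT (fun x => Y x 0 j)) ->
  measurable_fun setT (fun x => 'D_v h (Y x)).
Proof.
move=> dh mY.
have ch : continuous h by move=> w; exact: differentiable_continuous.
apply: (@measurable_fun_cvg _ _ _ _ (fun (m : nat) x =>
    (harmonic m)^-1 *: (h (harmonic m *: v + Y x) - h (Y x)))).
  move=> m; apply: measurable_funM => //; apply: measurable_funB; last first.
    exact: measurable_continuous_rV.
  apply: (@measurable_continuous_rV _ _ _ _ h (fun x => harmonic m *: v + Y x)) => // j.
  by under eq_fun do rewrite !mxE; apply: measurable_funD.
move=> x _.
(* The steps tend to 0 without ever being 0, as the punctured limit defining the derivative
   requires. *)
have hd : (@harmonic R) m @[m --> \oo] --> (0 : R)^'.
  move=> U hU.
  have h0 : \forall m \near \oo, harmonic m != 0 :> R -> U (harmonic m).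
    exact: (@cvg_harmonic R _ hU).
  suff : \forall m \near \oo, U (@harmonic R m) by [].
  apply: filterS h0 => m; apply; apply: lt0r_neq0; exact: harmonic_gt0.
exact: (cvg_comp _ _ hd (@diff_derivable _ _ _ h (Y x) v (dh _))).
Qed.

Lemma measurable_enorm (R : realType) (dT : measure_display)
    (T : measurableType dT) (d : nat) (Y : T -> 'rV[R]_d) :
  (forall j, measurable_fun setT (fun x => Y x 0 j)) ->
  measurable_fun setT (fun x => enorm (Y x)).
Proof.
move=> mY; apply: (measurableT_comp (continuous_measurable_fun (@sqrt_continuous R))).
by apply: measurable_sum => j; exact: measurable_funX.
Qed.

Lemma measurable_clip (R : realType) (dT : measure_display)
    (T : measurableType dT) (d : nat) (Y : T -> 'rV[R]_d) c j :
  (forall j, measurable_fun setT (fun x => Y x 0 j)) ->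
  measurable_fun setT (fun x => clip (Y x) c 0 j).
Proof.
move=> mY; rewrite /clip.
(* Writing the inverse norm as the power [-1] is valid at norm 0 too, and reduces the claim to
   measurability of [powR]. *)
under eq_fun do rewrite mxE -(powR_inv1 (enorm_ge0 _)).
apply: measurable_funM => //; apply: measurable_minr => //.
apply: measurable_funM => //; apply: (measurableT_comp (measurable_powR (-1))).
exact: measurable_enorm.
Qed.

(** * Independence of one source of randomness from the others *)

(** Only the generating family: cylinder events, stable under intersection, in which [B i0 = setT]
    leaves the source [i0] unconstrained. *)
Definition sigma_others {dO : measure_display} {R : realType}
    {Om : measurableType dO} {J : Type} (X : J -> Om -> R) (i0 : J) :
    set (set Om) :=
  [set E | exists B : J -> set R,
    [/\ forall i, measurable (B i), B i0 = setT &
        E = \bigcap_(i in [set: J]) (X i @^-1` B i)]].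

(** Stated on the generated space itself, so that closure properties of measurable functions apply
    to it directly. *)
Definition meas_others {dO : measure_display} {R : realType}
    {Om : measurableType dO} {J : Type} (X : J -> Om -> R) (i0 : J)
    (Y : Om -> R) :=
  @measurable_fun _ _ (g_sigma_algebraType (sigma_others X i0)) R setT Y.

Lemma meas_others_coord (dO : measure_display) (R : realType)
    (Om : measurableType dO) (J : eqType) (X : J -> Om -> R) i0 i :
  i != i0 -> meas_others X i0 (X i).
Proof.
move=> ii0 _ B mB; rewrite setTI; apply: sub_sigma_algebra.
exists (fun l => if l == i then B else setT); split.
- by move=> l; case: ifP.
- by rewrite eq_sym (negbTE ii0).
apply/seteqP; split => x /= => [Bx l _|/(_ i I)]; last by rewrite eqxx.
by case: ifPn => // /eqP ->.
Qed.

Lemma sigma_others_measurable (dO : measure_display) (R : realType)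
    (Om : measurableType dO) (J : finType) (X : J -> Om -> R) i0 :
  (forall i, measurable_fun setT (X i)) -> <<s sigma_others X i0 >> `<=` measurable.
Proof.
move=> mX; apply: smallest_sub; first exact: sigma_algebra_measurable.
move=> _ [B [mB _ ->]]; apply: fin_bigcap_measurable => // i _.
by rewrite -[X in measurable X]setTI; exact: mX.
Qed.

Lemma meas_others_measurable (dO : measure_display) (R : realType)
    (Om : measurableType dO) (J : finType) (X : J -> Om -> R) i0 Y :
  (forall i, measurable_fun setT (X i)) -> meas_others X i0 Y ->
  measurable_fun setT Y.
Proof.
move=> mX mY mT B mB; apply: (sigma_others_measurable mX).
exact: (mY measurableT B mB).
Qed.

(** For fixed [B], both sides are finite measures in [A]. They agree on the pi-system
    [sigma_others], hence on the sigma-algebra it generates. *)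
Lemma mutual_indep_others (dO : measure_display) (R : realType)
    (Om : measurableType dO) (P : probability Om R) (J : finType)
    (X : J -> Om -> R) (i0 : J) (A : set Om) (B : set R) :
  mutual_indep P X -> <<s sigma_others X i0 >> A -> measurable B ->
  (P (A `&` X i0 @^-1` B) = P A * P (X i0 @^-1` B))%E.
Proof.
move=> [mX hX] sA mB.
have mXB : measurable (X i0 @^-1` B).
  by rewrite -[X in measurable X]setTI; exact: mX.
have sub := @sigma_others_measurable _ _ _ _ X i0 mX.
have fin : P (X i0 @^-1` B) \is a fin_num by exact: fin_num_measure.
have r0 : (0 <= fine (P (X i0 @^-1` B)))%R by rewrite fine_ge0.
pose r : {nonneg R} := NngNum r0.
have mrE Z : mrestr P mXB Z = P (Z `&` X i0 @^-1` B) by [].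
have msE Z : mscale r P Z = (P (X i0 @^-1` B) * P Z)%E by rewrite -[in RHS](fineK fin).
have key : mrestr P mXB A = mscale r P A.
  apply: (@g_sigma_algebra_measure_unique _ R Om (sigma_others X i0)
    _ (fun=> setT)) => //.
  - by move=> C sC; apply: sub; exact: sub_sigma_algebra.
  - move=> _; exists (fun=> setT); split => //.
    by apply/esym; rewrite -subTset => x _ i.
  - by rewrite bigcup_const.
  - move=> _ _ [B1 [m1 e1 ->]] [B2 [m2 e2 ->]].
    exists (fun i => B1 i `&` B2 i); split.
    + by move=> i; exact: measurableI.
    + by rewrite e1 e2 setTI.
    + by rewrite -bigcapI; apply: eq_bigcapr => i _; rewrite preimage_setI.
  - move=> _ [C [mC eC ->]]; apply: (etrans (mrE _) (etrans _ (esym (msE _)))).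
    (* Since [C i0] is the full set, putting [B] in its place turns the intersection into another
       cylinder, to which mutual independence applies. *)
    pose C' i := if i == i0 then B else C i.
    have -> : \bigcap_(i in [set: J]) (X i @^-1` C i) `&` X i0 @^-1` B =
        \bigcap_(i in [set: J]) (X i @^-1` C' i).
      apply/seteqP; split => [x [Cx Bx] i _|x Cx].
        by rewrite /C' /=; case: eqP => [->//|_]; exact: (Cx i I).
      split; last by have := Cx i0 I; rewrite /C' /= eqxx.
      move=> i _; have [->|ii0] := eqVneq i i0; first by rewrite eC.
      by have := Cx i I; rewrite /C' /= (negbTE ii0).
    rewrite !hX//; last by move=> i; rewrite /C'; case: eqP.
    rewrite (bigD1 i0)//= [in RHS](bigD1 i0)//= {1}/C' eqxx eC preimage_setT.
    rewrite probability_setT mul1e; congr (_ * _)%E.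
    by apply: eq_bigr => i ii0; rewrite /C' (negbTE ii0).
  - by move=> _; rewrite [ltLHS]mrE setTI (le_lt_trans (probability_le1 _ _))// ltry.
exact: (etrans (esym (mrE A)) (etrans key (etrans (msE A) (muleC _ _)))).
Qed.

(** Tonelli on the absolute values gives integrability; Fubini then gives the value. *)
Lemma integrable_prod_mul (R : realType) (m1 m2 : probability R R) :
  m1.-integrable setT (EFin \o id) -> m2.-integrable setT (EFin \o id) ->
  (m1 \x m2)%E.-integrable setT (fun z => (z.1 * z.2)%:E) /\
  (\int[m1 \x m2]_z (z.1 * z.2)%:E =
   (\int[m1]_x x%:E) * (\int[m2]_x x%:E))%E.
Proof.
move=> i1 i2.
have mf : measurable_fun setT (fun z : R * R => (z.1 * z.2)%:E).
  by apply/measurable_EFinP; exact: measurable_funM.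
have ii : (m1 \x m2)%E.-integrable setT (fun z => (z.1 * z.2)%:E).
  apply/(integrable12ltyP _ _ mf) => /=.
  have n2 : (\int[m2]_y `|y%:E| < +oo)%E by case/integrableP : i2.
  have n2f : (\int[m2]_y `|y%:E|)%E \is a fin_num.
    by rewrite ge0_fin_numE// integral_ge0.
  have inner x : (\int[m2]_y `|(x * y)%:E| =
      (fine (\int[m2]_y `|y%:E|))%:E * (`|x|)%:E)%E.
    have e y : (`|(x * y)%:E| = (`|x|)%:E * `|y%:E|)%E.
      by rewrite EFinM abseM.
    under eq_integral do rewrite e.
    rewrite ge0_integralZl_EFin//; last exact: measurableT_comp.
    by rewrite (fineK n2f) muleC.
  under eq_integral do rewrite inner.
  rewrite ge0_integralZl_EFin//; last 2 first.
  - exact: measurableT_comp.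
  - by rewrite fine_ge0// integral_ge0.
  by rewrite lte_mul_pinfty ?lee_fin ?fine_ge0 ?integral_ge0//; case/integrableP : i1.
split => //; rewrite -integral12_prod_meas1// /fubini_F /=.
have f2 : (\int[m2]_y y%:E)%E \is a fin_num by exact: integrable_fin_num.
have inner x : (\int[m2]_y (x * y)%:E =
    (fine (\int[m2]_y y%:E))%:E * x%:E)%E.
  by under eq_integral do rewrite EFinM; rewrite integralZl// fineK// muleC.
under eq_integral do rewrite inner.
by rewrite integralZl// fineK// muleC.
Qed.

(** Independence on rectangles identifies the joint law of [Y] and [X i0] with the product of their
    laws, so the claim becomes a statement about a product measure. *)
Lemma expectation_mul_others (dO : measure_display) (R : realType)
    (Om : measurableType dO) (P : probability Om R) (J : finType)
    (X : J -> Om -> R) (i0 : J) (Y : Om -> R) :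
  mutual_indep P X -> meas_others X i0 Y ->
  P.-integrable setT (EFin \o Y) -> P.-integrable setT (EFin \o X i0) ->
  P.-integrable setT (EFin \o (fun x => Y x * X i0 x)) /\
  \int[P]_x (Y x * X i0 x) = (\int[P]_x Y x) * (\int[P]_x X i0 x).
Proof.
move=> iX mY' iY iXi.
have mX := proj1 iX; have mY := meas_others_measurable mX mY'.
pose Y1 := mfun_Sub (mem_set mY : Y \in mfun).
pose X1 := mfun_Sub (mem_set (mX i0) : X i0 \in mfun).
have mYX : measurable_fun setT (fun x => (Y x, X i0 x)).
  exact: measurable_fun_pair.
pose YX := mfun_Sub (mem_set mYX : (fun x => (Y x, X i0 x)) \in mfun).
have law C : measurable C ->
    (distribution P Y1 \x distribution P X1)%E C = distribution P YX C.
  apply: product_measure_unique => A B mA mB.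
  rewrite /distribution /pushforward /= -(@mutual_indep_others _ _ _ _ _ X)//.
  by have := mY' measurableT _ mA; rewrite setTI.
have i1 : (distribution P Y1).-integrable setT (EFin \o id).
  by apply: integrable_pushforward => //; first [exact: iY|exact/measurable_EFinP].
have i2 : (distribution P X1).-integrable setT (EFin \o id).
  by apply: integrable_pushforward => //; first [exact: iXi|exact/measurable_EFinP].
have [ip ep] := integrable_prod_mul i1 i2.
have mf : measurable_fun setT (fun z : R * R => (z.1 * z.2)%:E).
  by apply/measurable_EFinP; exact: measurable_funM.
have ipP : P.-integrable setT (EFin \o (fun x => Y x * X i0 x)).
  apply/integrableP; split.
    by apply/measurable_EFinP; exact: measurable_funM.
  case/integrableP : ip => _.
  rewrite (eq_measure_integral (distribution P YX)); last by move=> C mC _; exact: law.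
  by rewrite ge0_integral_distribution//; exact: measurableT_comp.
split => //; rewrite /Rintegral -fineM; try exact: integrable_fin_num.
congr fine.
have := ep; rewrite (eq_measure_integral (distribution P YX)); last first.
  by move=> C mC _; exact: law.
rewrite integral_distribution//= => ->.
by congr (_ * _)%E; rewrite integral_distribution.
Qed.

(** * Gaussian moments *)

Lemma measurable_expR_comp (d : measure_display) (T : measurableType d)
    (R : realType) (f : T -> R) : measurable_fun setT f ->
  measurable_fun setT (fun x => expR (f x)).
Proof. exact: (measurableT_comp (@measurable_expR R)). Qed.

Lemma normal_pdf_peakE (R : realType) (m s x : R) : s != 0 ->
  normal_pdf m s x = normal_peak s * normal_fun m s x.
Proof. by rewrite /normal_pdf => /negbTE ->. Qed.

(** The Radon-Nikodym derivative of the normal law coincides almost everywhere with [normal_pdf],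
    both having the same integrals over measurable sets. *)
Lemma ge0_integral_normal_prob (R : realType) (m s : R) (f : R -> R) :
  measurable_fun setT f -> (forall x, 0 <= f x) ->
  (\int[normal_prob m s]_x (f x)%:E =
   \int[lebesgue_measure]_x (f x * normal_pdf m s x)%:E)%E.
Proof.
move=> mf f0; have dom := normal_prob_dominates m s.
rewrite -(Radon_Nikodym_SigmaFinite.change_of_variables dom)//=; last first.
  exact/measurable_EFinP.
have mg := measurable_int _ (Radon_Nikodym_SigmaFinite.f_integrable dom).
apply: ae_eq_integral => //.
- by apply: emeasurable_funM => //; exact/measurable_EFinP.
- apply/measurable_EFinP; apply: measurable_funM => //.
  exact: measurable_normal_pdf.
have ae1 : ae_eq lebesgue_measure setT
    (Radon_Nikodym_SigmaFinite.f (normal_prob m s) lebesgue_measure)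
    (fun x => (normal_pdf m s x)%:E).
  apply: integral_ae_eq => //.
  - exact: Radon_Nikodym_SigmaFinite.f_integrable.
  - by apply/measurable_EFinP; exact: measurable_normal_pdf.
  - by move=> E _ mE; rewrite -Radon_Nikodym_SigmaFinite.f_integral.
by apply: filterS ae1 => x /= /(_ I) ->; rewrite EFinM.
Qed.

(** Completing the square: an exponential tilt shifts the mean by [a * s ^+ 2]. *)
Lemma expR_mul_normal_pdf (R : realType) (a s x : R) : s != 0 ->
  expR (a * x) * normal_pdf 0 s x =
  expR (a ^+ 2 * s ^+ 2 / 2) * normal_pdf (a * s ^+ 2) s x.
Proof.
move=> s0; rewrite !normal_pdf_peakE// !(mulrCA (expR _)) /normal_fun -!expRD.
by apply: (congr1 (fun z => normal_peak s * expR z)); field.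
Qed.

(** The exponent is the difference of the two Gaussian exponents, so the tilt changes the deviation
    from [s] to [s']; [s' / s] is the ratio of the normalizing constants. *)
Lemma expR_sqr_mul_normal_pdf (R : realType) (s s' x : R) : 0 < s -> 0 < s' ->
  expR ((s ^- 2 - s' ^- 2) / 2 * x ^+ 2) * normal_pdf 0 s x =
  s' / s * normal_pdf 0 s' x.
Proof.
move=> s0 s'0; rewrite !normal_pdf_peakE ?gt_eqF//.
have hp : normal_peak s = s' / s * normal_peak s'.
  have sq t : 0 < t -> Num.sqrt (t ^+ 2 * (pi *+ 2)) = t * Num.sqrt (pi *+ 2).
    by move=> t0; rewrite sqrtrM ?sqr_ge0// sqrtr_sqr gtr0_norm.
  rewrite /normal_peak -!mulrnAr !sq//.
  have q0 : Num.sqrt (pi *+ 2) != 0 :> R.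
    by rewrite gt_eqF// sqrtr_gt0 pmulrn_lgt0// pi_gt0.
  by field; rewrite q0 !gt_eqF.
have he : (s ^- 2 - s' ^- 2) / 2 * x ^+ 2 + - (x - 0) ^+ 2 / (s ^+ 2 *+ 2) =
    - (x - 0) ^+ 2 / (s' ^+ 2 *+ 2).
  by field; rewrite !gt_eqF.
by rewrite (mulrCA (expR _)) /normal_fun -expRD he hp mulrA.
Qed.

Lemma integral_mull_normal_pdf (R : realType) (c m s : R) :
  (\int[lebesgue_measure]_x (c * normal_pdf m s x)%:E = c%:E)%E.
Proof.
under eq_integral do rewrite EFinM.
by rewrite integralZl ?integral_normal_pdf ?mule1//; exact: integrable_normal_pdf.
Qed.

Lemma normal_expR (R : realType) (a s : R) : s != 0 ->
  (\int[normal_prob 0 s]_x (expR (a * x))%:E =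
   (expR (a ^+ 2 * s ^+ 2 / 2))%:E)%E.
Proof.
move=> s0; rewrite ge0_integral_normal_prob//; last first.
  by apply: measurable_expR_comp; exact: mulrl_measurable.
under eq_integral do rewrite expR_mul_normal_pdf//.
exact: integral_mull_normal_pdf.
Qed.

Lemma normal_expR_sqr (R : realType) (s s' : R) : 0 < s -> 0 < s' ->
  (\int[normal_prob 0 s]_x (expR ((s ^- 2 - s' ^- 2) / 2 * x ^+ 2))%:E =
   (s' / s)%:E)%E.
Proof.
move=> s0 s'0; rewrite ge0_integral_normal_prob//; last first.
  by apply: measurable_expR_comp; apply: measurable_funM => //;
    exact: measurable_funX.
under eq_integral do rewrite expR_sqr_mul_normal_pdf//.
exact: integral_mull_normal_pdf.
Qed.

Lemma probability_integral1 (d : measure_display) (T : measurableType d)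
    (R : realType) (P : probability T R) : (\int[P]_x 1 = 1)%E.
Proof. by rewrite integral_cst// mul1e; exact: probability_setT. Qed.

(** Integrating [1 + c x^2 <= exp (c x^2)], whose right side has integral [s' / s], bounds the
    second moment for every [s' > s]; then [s'] decreases to [s]. *)
Lemma normal_second_moment (R : realType) (s : R) : 0 < s ->
  (\int[normal_prob 0 s]_x (x ^+ 2)%:E <= (s ^+ 2)%:E)%E.
Proof.
move=> s0.
have mX : measurable_fun setT (fun x : R => (x ^+ 2)%:E).
  by apply/measurable_EFinP; exact: exprn_measurable.
have key s' : s < s' -> (\int[normal_prob 0 s]_x (x ^+ 2)%:E <= (s' ^+ 2)%:E)%E.
  move=> ss'; have s'0 := lt_trans s0 ss'.
  set c := (s ^- 2 - s' ^- 2) / 2.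
  (* In this form, dividing [(s' - s) / s] by [c] leaves [2 s s'^2 / (s' + s)], which is at most
     [s'^2]. *)
  have cE : c = (s' - s) * (s' + s) / (2 * s ^+ 2 * s' ^+ 2).
    by rewrite /c; field; rewrite !gt_eqF.
  have c0 : 0 < c.
    by rewrite cE divr_gt0 ?mulr_gt0 ?exprn_gt0 ?subr_gt0 ?addr_gt0.
  have mcX : measurable_fun setT (fun x : R => c * x ^+ 2).
    by apply: measurable_funM => //; exact: exprn_measurable.
  have : (\int[normal_prob 0 s]_x (c * x ^+ 2 + 1)%:E <= (s' / s)%:E)%E.
    rewrite -normal_expR_sqr//; apply: ge0_le_integral => //.
    - by move=> x _; rewrite lee_fin addr_ge0// mulr_ge0 ?sqr_ge0// ltW.
    - by apply/measurable_EFinP; exact: measurable_funD.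
    - by apply/measurable_EFinP; exact: measurable_expR_comp.
    - by move=> x _; rewrite lee_fin addrC expR_ge1Dx.
  under eq_integral do rewrite EFinD.
  rewrite ge0_integralD//=; last first.
  - exact/measurable_EFinP.
  - by move=> x _; rewrite lee_fin mulr_ge0 ?sqr_ge0// ltW.
  under eq_integral do rewrite EFinM.
  rewrite ge0_integralZl_EFin ?(ltW c0)//; last first.
    by move=> x _; rewrite lee_fin sqr_ge0.
  rewrite probability_integral1.
  have : (0 <= \int[normal_prob 0 s]_x (x ^+ 2)%:E)%E.
    by apply: integral_ge0 => x _; rewrite lee_fin sqr_ge0.
  case: (\int[normal_prob 0 s]_x (x ^+ 2)%:E)%E => [r| |] //.
  - rewrite !lee_fin => r0 h.
    have {}h : c * r <= (s' - s) / s.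
      by rewrite mulrBl divff ?gt_eqF// lerBrDr.
    rewrite -(ler_pM2l c0); apply: (le_trans h); rewrite cE.
    have -> : (s' - s) * (s' + s) / (2 * s ^+ 2 * s' ^+ 2) * s' ^+ 2 =
      (s' - s) / s * ((s' + s) / (2 * s)) by field; rewrite !gt_eqF.
    rewrite ler_peMr ?divr_ge0 ?subr_ge0 ?(ltW ss') ?(ltW s0)//.
    by rewrite ler_pdivlMr ?mulr_gt0//; lra.
  - by rewrite gt0_muley ?lte_fin.
apply/lee_addgt0Pr => e e0.
have es : s < Num.sqrt (s ^+ 2 + e).
  by rewrite -{1}(gtr0_norm s0) -sqrtr_sqr ltr_sqrt ?ltrDl// addr_gt0 ?exprn_gt0.
apply: (le_trans (key _ es)).
by rewrite sqr_sqrtr ?addr_ge0 ?sqr_ge0 ?(ltW e0)// EFinD.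
Qed.

Lemma normal_integrable_sqr (R : realType) (s : R) : 0 < s ->
  (normal_prob 0 s).-integrable setT (fun x : R => (x ^+ 2)%:E).
Proof.
move=> s0; apply/integrableP; split.
  by apply/measurable_EFinP; exact: exprn_measurable.
under eq_integral do rewrite gee0_abs ?lee_fin ?sqr_ge0//.
by apply: (le_lt_trans (normal_second_moment s0)); rewrite ltry.
Qed.

Lemma normal_integrable_id (R : realType) (s : R) : 0 < s ->
  (normal_prob 0 s).-integrable setT (fun x : R => x%:E).
Proof.
move=> s0; have h := normal_integrable_sqr s0.
have h1 : (normal_prob 0 s).-integrable setT (fun x : R => (1:R)%:E).
  exact: finite_measure_integrable_cst.
apply: le_integrable (integrableD measurableT h h1) => //.
- exact/measurable_EFinP.
- move=> x _ /=; rewrite lee_fin [leRHS]ger0_norm ?addr_ge0 ?sqr_ge0//.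
  by rewrite ler_norml; nra.
Qed.

(** Integrating [1 + a x <= exp (a x)] gives [a r <= exp (a^2 s^2 / 2) - 1] for the mean [r]. The
    right side is of order [a^2], so small [a] of either sign force [r = 0]. *)
Lemma normal_mean (R : realType) (s : R) : 0 < s ->
  (\int[normal_prob 0 s]_x x%:E = 0)%E.
Proof.
move=> s0; have h := normal_integrable_id s0.
have key a : (a%:E * (\int[normal_prob 0 s]_x x%:E) <=
    (expR (a ^+ 2 * s ^+ 2 / 2) - 1)%:E)%E.
  have mE : measurable_fun setT (fun x : R => (expR (a * x))%:E).
    by apply/measurable_EFinP/measurable_expR_comp; exact: mulrl_measurable.
  have iE : (normal_prob 0 s).-integrable setT (fun x : R => (expR (a * x))%:E).
    apply/integrableP; split=> //.
    under eq_integral do rewrite gee0_abs ?lee_fin ?expR_ge0//.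
    by rewrite normal_expR ?gt_eqF// ltry.
  have i1 : (normal_prob 0 s).-integrable setT (fun x : R => 1%E).
    exact: finite_measure_integrable_cst.
  rewrite -integralZl// EFinB -normal_expR ?gt_eqF//.
  rewrite -[X in (_ - X)%E](probability_integral1 (normal_prob 0 s)).
  rewrite -integralB//; apply: le_integral => //.
  - exact: integrableZl.
  - exact: integrableB.
  - by move=> x _; rewrite -EFinB -EFinM lee_fin lerBrDl expR_ge1Dx.
have : (\int[normal_prob 0 s]_x x%:E)%E \is a fin_num by exact: integrable_fin_num.
move: key; case: (\int[normal_prob 0 s]_x x%:E)%E => [r| |] // key _.
have {}key a : 0 <= expR (a ^+ 2 * s ^+ 2 / 2) - 1 - a * r.
  by have := key a; rewrite -EFinM lee_fin subr_ge0.
(* This uses [exp y - 1 <= y exp y] for [y = a^2 s^2 / 2], with [exp y] bounded by its value at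
   [a = 1]. *)
have ub a : `|a| <= 1 -> a * r <= a ^+ 2 * (s ^+ 2 / 2 * expR (s ^+ 2 / 2)).
  move=> a1; have := key a; rewrite subr_ge0 => /le_trans; apply.
  have a21 : a ^+ 2 <= 1 by move: a1; rewrite ler_norml => /andP[]; nra.
  set y := a ^+ 2 * s ^+ 2 / 2.
  have y0 : 0 <= y by rewrite /y divr_ge0// mulr_ge0 ?sqr_ge0.
  have h1 : expR y - 1 <= y * expR y.
    have := expR_ge1Dx (- y); rewrite expRN => h2.
    have := ler_wpM2r (expR_ge0 y) h2; rewrite mulVf ?gt_eqF ?expR_gt0//.
    by rewrite mulrDl mul1r mulNr; lra.
  apply: (le_trans h1).
  have -> : a ^+ 2 * (s ^+ 2 / 2 * expR (s ^+ 2 / 2)) = y * expR (s ^+ 2 / 2).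
    by rewrite /y; ring.
  rewrite ler_wpM2l// ler_expR /y -mulrA ler_piMl// divr_ge0 ?sqr_ge0//.
set c := s ^+ 2 / 2 * expR (s ^+ 2 / 2) in ub.
have c0 : 0 < c by rewrite mulr_gt0 ?expR_gt0 ?divr_gt0 ?exprn_gt0.
congr EFin; apply/eqP; rewrite -normr_le0; apply/ler_addgt0Pr => e e0.
(* This choice ensures both [a <= 1] and [a c <= e]; applying [ub] to [a] and [- a] bounds [r] by
   [e] on both sides. *)
rewrite add0r; pose a := Num.min 1 (e / c).
have a0 : 0 < a by rewrite lt_min ltr01 divr_gt0.
have a1 : a <= 1 by rewrite ge_min lexx.
have ac : a * c <= e by rewrite -ler_pdivlMr// ge_min lexx orbT.
rewrite ler_norml; apply/andP; split.
  have := ub (- a); rewrite normrN gtr0_norm// => /(_ a1).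
  rewrite sqrrN mulNr expr2 -mulrA -mulrN ler_pM2l//; lra.
have := ub a; rewrite gtr0_norm// => /(_ a1).
by rewrite expr2 -mulrA ler_pM2l//; lra.
Qed.

(** * Integrable and square-integrable random variables *)

Definition Rintegrable {dO : measure_display} {R : realType}
    {T : measurableType dO} (P : probability T R) (X : T -> R) :=
  P.-integrable setT (EFin \o X).

(** Measurability of [X] is a separate clause because integrability of the square does not imply
    it. *)
Definition sqintegrable {dO : measure_display} {R : realType}
    {T : measurableType dO} (P : probability T R) (X : T -> R) :=
  measurable_fun setT X /\ Rintegrable P (fun x => X x ^+ 2).

Lemma Rintegrable_le (dO : measure_display) (R : realType)
    (T : measurableType dO) (P : probability T R) (X Y : T -> R) :
  measurable_fun setT X -> (forall x, `|X x| <= `|Y x|) ->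
  Rintegrable P Y -> Rintegrable P X.
Proof.
move=> mX XY iY; apply: le_integrable iY => //; first exact/measurable_EFinP.
by move=> x _; rewrite lee_fin.
Qed.

Lemma Rintegrable_cst (dO : measure_display) (R : realType)
    (T : measurableType dO) (P : probability T R) (c : R) :
  Rintegrable P (fun=> c).
Proof. exact: finite_measure_integrable_cst. Qed.

Lemma RintegrableZ (dO : measure_display) (R : realType)
    (T : measurableType dO) (P : probability T R) (c : R) (X : T -> R) :
  Rintegrable P X -> Rintegrable P (fun x => c * X x).
Proof. by move=> iX; exact: (integrableZl measurableT c iX). Qed.

Lemma RintegrableD (dO : measure_display) (R : realType)
    (T : measurableType dO) (P : probability T R) (X Y : T -> R) :
  Rintegrable P X -> Rintegrable P Y -> Rintegrable P (fun x => X x + Y x).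
Proof. by move=> iX iY; exact: (integrableD measurableT iX iY). Qed.

Lemma RintegrableB (dO : measure_display) (R : realType)
    (T : measurableType dO) (P : probability T R) (X Y : T -> R) :
  Rintegrable P X -> Rintegrable P Y -> Rintegrable P (fun x => X x - Y x).
Proof. by move=> iX iY; exact: (integrableB measurableT iX iY). Qed.

Lemma Rintegrable_sum (dO : measure_display) (R : realType)
    (T : measurableType dO) (P : probability T R) (J : finType) (F : J -> T -> R) :
  (forall i, Rintegrable P (F i)) -> Rintegrable P (fun x => \sum_i F i x).
Proof.
move=> iF; elim: (index_enum J) => [|i s ih].
  rewrite (_ : (fun _ => _) = (fun=> 0)); first exact: Rintegrable_cst.
  by apply/funext => x; rewrite big_nil.
rewrite (_ : (fun _ => _) = (fun x => F i x + \sum_(l <- s) F l x)).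
  exact: RintegrableD.
by apply/funext => x; rewrite big_cons.
Qed.

Lemma Rexp_cst (dO : measure_display) (R : realType)
    (T : measurableType dO) (P : probability T R) (c : R) :
  \int[P]_x c = c.
Proof.
transitivity (c * fine (P setT)); first exact: Rintegral_cst.
by rewrite probability_setT mulr1.
Qed.

Lemma Rexp_sum (dO : measure_display) (R : realType)
    (T : measurableType dO) (P : probability T R) (J : finType) (F : J -> T -> R) :
  (forall i, Rintegrable P (F i)) ->
  \int[P]_x (\sum_i F i x) = \sum_i \int[P]_x F i x.
Proof.
move=> iF.
suff : forall s : seq J, Rintegrable P (fun x => \sum_(i <- s) F i x) /\
  \int[P]_x (\sum_(i <- s) F i x) = \sum_(i <- s) \int[P]_x F i x.
  by move=> /(_ (index_enum J))[].
elim=> [|i s [ih1 ih2]].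
  have -> : (fun x => \sum_(i <- [::]) F i x) = (fun=> 0).
    by apply/funext => x; rewrite big_nil.
  by rewrite Rexp_cst big_nil; split => //; exact: Rintegrable_cst.
have -> : (fun x => \sum_(l <- i :: s) F l x) =
    (fun x => F i x + \sum_(l <- s) F l x).
  by apply/funext => x; rewrite big_cons.
split; first exact: RintegrableD.
by rewrite big_cons -ih2; apply: RintegralD => //; exact: iF.
Qed.

Lemma sqintegrable_mul (dO : measure_display) (R : realType)
    (T : measurableType dO) (P : probability T R) (X Y : T -> R) :
  sqintegrable P X -> sqintegrable P Y -> Rintegrable P (fun x => X x * Y x).
Proof.
move=> [mX iX] [mY iY]; apply: Rintegrable_le (RintegrableD iX iY).
  exact: measurable_funM.
move=> x; rewrite [leRHS]ger0_norm ?addr_ge0 ?sqr_ge0// ler_norml.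
by apply/andP; split; nra.
Qed.

Lemma sqintegrable_cst (dO : measure_display) (R : realType)
    (T : measurableType dO) (P : probability T R) (c : R) :
  sqintegrable P (fun=> c).
Proof. by split => //; exact: Rintegrable_cst. Qed.

Lemma sqintegrable_Rintegrable (dO : measure_display) (R : realType)
    (T : measurableType dO) (P : probability T R) (X : T -> R) :
  sqintegrable P X -> Rintegrable P X.
Proof.
move=> sX; have := sqintegrable_mul sX (sqintegrable_cst P 1).
by under eq_fun do rewrite mulr1.
Qed.

Lemma sqintegrableD (dO : measure_display) (R : realType)
    (T : measurableType dO) (P : probability T R) (X Y : T -> R) :
  sqintegrable P X -> sqintegrable P Y -> sqintegrable P (fun x => X x + Y x).
Proof.
move=> sX sY; have [[mX iX] [mY iY]] := (sX, sY).
split; first exact: measurable_funD.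
have -> : (fun x => (X x + Y x) ^+ 2) =
    (fun x => X x ^+ 2 + (2 * (X x * Y x) + Y x ^+ 2)).
  by apply/funext => x; ring.
apply: RintegrableD => //; apply: RintegrableD => //.
by apply: RintegrableZ; exact: sqintegrable_mul.
Qed.

Lemma sqintegrableZ (dO : measure_display) (R : realType)
    (T : measurableType dO) (P : probability T R) (c : R) (X : T -> R) :
  sqintegrable P X -> sqintegrable P (fun x => c * X x).
Proof.
move=> [mX iX]; split; first exact: measurable_funM.
have -> : (fun x => (c * X x) ^+ 2) = (fun x => c ^+ 2 * (X x ^+ 2)).
  by apply/funext => x; ring.
exact: RintegrableZ.
Qed.

Lemma sqintegrable_sum (dO : measure_display) (R : realType)
    (T : measurableType dO) (P : probability T R) (J : finType) (F : J -> T -> R) :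
  (forall i, sqintegrable P (F i)) -> sqintegrable P (fun x => \sum_i F i x).
Proof.
move=> iF; elim: (index_enum J) => [|i s ih].
  rewrite (_ : (fun _ => _) = (fun=> 0)); first exact: sqintegrable_cst.
  by apply/funext => x; rewrite big_nil.
rewrite (_ : (fun _ => _) = (fun x => F i x + \sum_(l <- s) F l x)).
  exact: sqintegrableD.
by apply/funext => x; rewrite big_cons.
Qed.

Lemma sqintegrable_bounded (dO : measure_display) (R : realType)
    (T : measurableType dO) (P : probability T R) (c : R) (X : T -> R) :
  measurable_fun setT X -> (forall x, `|X x| <= c) -> sqintegrable P X.
Proof.
move=> mX bX; split => //.
apply: Rintegrable_le (Rintegrable_cst P (c ^+ 2)); first exact: measurable_funX.
move=> x; rewrite !normrX lerXn2r ?nnegrE//.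
by rewrite (le_trans (bX x))// ler_norm.
Qed.

(** Nonnegativity of the variance gives [m ^+ 2 <= a ^+ 2] for the mean [m]. *)
Lemma Rexp_le_sqr (dO : measure_display) (R : realType)
    (T : measurableType dO) (P : probability T R) (a : R) (X : T -> R) :
  sqintegrable P X -> 0 <= a -> \int[P]_x (X x ^+ 2) <= a ^+ 2 ->
  \int[P]_x X x <= a.
Proof.
move=> sX a0 h; have iX := sqintegrable_Rintegrable sX; have iX2 := proj2 sX.
set m := \int[P]_x X x.
have : 0 <= \int[P]_x (X x ^+ 2 - 2 * m * X x + m ^+ 2).
  apply: Rintegral_ge0 => x _.
  by have := sqr_ge0 (X x - m); rewrite sqrrB; lra.
rewrite RintegralD//; last 2 first.
- by apply: RintegrableB => //; exact: RintegrableZ.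
- exact: Rintegrable_cst.
rewrite RintegralB//; last exact: RintegrableZ.
rewrite RintegralZl// Rexp_cst -/m => h2.
have {}h2 : m ^+ 2 <= a ^+ 2 by lra.
by have [//|am] := leP m a; nra.
Qed.

(** * One step of DP-SGD *)

Lemma meas_othersM (dO : measure_display) (R : realType)
    (Om : measurableType dO) (J : finType) (X : J -> Om -> R) i0 (Y Z : Om -> R) :
  meas_others X i0 Y -> meas_others X i0 Z -> meas_others X i0 (fun x => Y x * Z x).
Proof. exact: measurable_funM. Qed.

Lemma meas_others_sum (dO : measure_display) (R : realType)
    (Om : measurableType dO) (J K : finType) (X : J -> Om -> R) i0
    (Y : K -> Om -> R) :
  (forall k, meas_others X i0 (Y k)) -> meas_others X i0 (fun x => \sum_k Y k x).
Proof. by move=> mY; exact: measurable_sum. Qed.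

(** Abstract one-step estimate: [X (ki i)] are the 0/1 inclusion variables, [X (kz j)] the noise
    coordinates, [u] the current displacement from the minimizer and [c] the clipped gradients. The
    [meas_others] hypotheses express that [u] and [c] depend on the past only. *)
Lemma sgd_step (dO : measure_display) (R : realType)
    (Om : measurableType dO) (P : probability Om R) (J : finType)
    (X : J -> Om -> R) (n d : nat) (ki : 'I_n -> J) (kz : 'I_d -> J)
    (b tau s2 eta : R) (u : 'I_d -> Om -> R) (c : 'I_n -> 'I_d -> Om -> R) :
  mutual_indep P X -> injective ki -> (forall i j, ki i != kz j) ->
  (forall i x, X (ki i) x ^+ 2 = X (ki i) x) ->
  (forall i, \int[P]_x X (ki i) x = b / n%:R) ->
  (forall j, sqintegrable P (X (kz j))) ->
  (forall j, \int[P]_x X (kz j) x = 0) ->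
  (forall j, \int[P]_x (X (kz j) x ^+ 2) <= s2) ->
  (forall i j, meas_others X (ki i) (u j)) ->
  (forall j, meas_others X (kz j) (u j)) ->
  (forall i i' j, meas_others X (ki i) (c i' j)) ->
  (forall i j, meas_others X (kz j) (c i j)) ->
  (forall j, sqintegrable P (u j)) ->
  (forall i j x, `|c i j x| <= tau) ->
  (forall i i' x, \sum_j c i j x * c i' j x <= tau ^+ 2) ->
  (0 < n)%N -> 1 <= b ->
  \int[P]_x (\sum_j (u j x - eta *
      (b^-1 * (\sum_i X (ki i) x * c i j x) + X (kz j) x)) ^+ 2) <=
  \int[P]_x (\sum_j u j x ^+ 2)
  - 2 * eta * \int[P]_x (\sum_j (n%:R^-1 * \sum_i c i j x) * u j x)
  + eta ^+ 2 * (2 * tau ^+ 2 + d%:R * s2).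
Proof.
move=> iX ki_inj kiz X2 EX sZ EZ EZ2 mui muz mci mcz su bc dc n0 b1.
have mX := proj1 iX.
have b0 : 0 < b by lra.
have n0' : n%:R != 0 :> R by rewrite pnatr_eq0 -lt0n.
have bX i x : `|X (ki i) x| <= 1.
  have := X2 i x; rewrite ler_norml => h.
  have : X (ki i) x * (X (ki i) x - 1) = 0 by rewrite mulrBr mulr1 -expr2 h subrr.
  by move/eqP; rewrite mulf_eq0 subr_eq0 => /orP[]/eqP ->; apply/andP; split; lra.
have sX i : sqintegrable P (X (ki i)) by exact: sqintegrable_bounded (bX i).
have mc i j : measurable_fun setT (c i j).
  exact: (meas_others_measurable mX (mcz i j)).
have sc i j : sqintegrable P (c i j) by exact: sqintegrable_bounded (bc i j).
pose S j x := \sum_i X (ki i) x * c i j x.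
have sXc i j : sqintegrable P (fun x => X (ki i) x * c i j x).
  apply: (@sqintegrable_bounded _ _ _ _ tau); first exact: measurable_funM.
  move=> x; rewrite normrM -[leRHS]mul1r; apply: ler_pM => //.
have sS j : sqintegrable P (S j) by apply: sqintegrable_sum => i.
have mS j : meas_others X (kz j) (S j).
  apply: meas_others_sum => i; apply: meas_othersM => //.
  exact: meas_others_coord.
pose g j x := b^-1 * S j x + X (kz j) x.
have sg j : sqintegrable P (g j) by apply: sqintegrableD => //; exact: sqintegrableZ.
(* The product rule pulls out [b / n] from each inclusion variable, which with [b^-1] leaves the
   plain mean; the centred noise contributes nothing. *)
have E1 j : \int[P]_x (u j x * g j x) =
    \int[P]_x ((n%:R^-1 * \sum_i c i j x) * u j x).
  have iuc i : Rintegrable P (fun x => c i j x * u j x) by exact: sqintegrable_mul.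
  have h i := expectation_mul_others iX
    (meas_othersM (mci i i j) (mui i j)) (iuc i) (sqintegrable_Rintegrable (sX i)).
  have [hz1 hz2] := expectation_mul_others iX (muz j)
    (sqintegrable_Rintegrable (su j)) (sqintegrable_Rintegrable (sZ j)).
  have -> : (fun x => u j x * g j x) = (fun x => b^-1 *
      (\sum_i c i j x * u j x * X (ki i) x) + u j x * X (kz j) x).
    apply/funext => x; rewrite /g /S mulrDr mulrCA; congr (_ * _ + _).
    by rewrite mulr_sumr; apply: eq_bigr => i _; ring.
  have iS : Rintegrable P (fun x => \sum_i c i j x * u j x * X (ki i) x).
    by apply: Rintegrable_sum => i; have [] := h i.
  rewrite RintegralD//; last exact: RintegrableZ.
  rewrite hz2 EZ mulr0 addr0 RintegralZl// Rexp_sum; last by move=> i; have [] := h i.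
  have -> : (fun x => n%:R^-1 * (\sum_i c i j x) * u j x) =
      (fun x => n%:R^-1 * (\sum_i c i j x * u j x)).
    by apply/funext => x; rewrite -mulrA mulr_suml.
  rewrite RintegralZl//; last exact: Rintegrable_sum.
  rewrite Rexp_sum// !mulr_sumr; apply: eq_bigr => i _.
  have [_ ->] := h i; rewrite EX; field; rewrite n0' gt_eqF//.
have E2 j : \int[P]_x (g j x ^+ 2) <= b ^- 2 * \int[P]_x (S j x ^+ 2) + s2.
  have [h1 h2] := expectation_mul_others iX (mS j)
    (sqintegrable_Rintegrable (sS j)) (sqintegrable_Rintegrable (sZ j)).
  have -> : (fun x => g j x ^+ 2) = (fun x => b ^- 2 * S j x ^+ 2 +
      (2 * b^-1 * (S j x * X (kz j) x) + X (kz j) x ^+ 2)).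
    by apply/funext => x; rewrite /g; field; rewrite gt_eqF.
  have iS := proj2 (sS j); have iZ := proj2 (sZ j).
  rewrite RintegralD//; last 2 first.
  - exact: RintegrableZ.
  - by apply: RintegrableD => //; exact: RintegrableZ.
  rewrite RintegralD//; last exact: RintegrableZ.
  rewrite !RintegralZl// h2 EZ !mulr0 add0r lerD2l//.
(* Gram entries of the clipped gradients: the squared norm of [S] is the sum of [D i i'] weighted by
   pairs of inclusion variables. *)
pose D i i' x := \sum_j c i j x * c i' j x.
have sD i i' : sqintegrable P (D i i').
  apply: sqintegrable_sum => j; apply: (@sqintegrable_bounded _ _ _ _ (tau * tau)).
    exact: measurable_funM.
  by move=> x; rewrite normrM; apply: ler_pM.
have EXD i i' : \int[P]_x (D i i' x * X (ki i) x) = \int[P]_x (D i i' x) * (b / n%:R).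
  rewrite -(EX i); have [] := @expectation_mul_others _ _ _ P _ X (ki i) (D i i') iX => //.
  - by apply: meas_others_sum => j; exact: meas_othersM.
  - exact: sqintegrable_Rintegrable.
  - exact: sqintegrable_Rintegrable.
have ED i i' : \int[P]_x (D i i' x) <= tau ^+ 2.
  rewrite -[leRHS](Rexp_cst P); apply: le_Rintegral => //.
  - exact: sqintegrable_Rintegrable.
  - exact: Rintegrable_cst.
  - by move=> x _; exact: dc.
have p0 : 0 <= b / n%:R by rewrite divr_ge0 ?ler0n// ltW.
have iDX : forall i i', Rintegrable P (fun x => D i i' x * X (ki i) x).
  by move=> i i'; exact: sqintegrable_mul.
(* For distinct indices [D i i' * X (ki i)] is still measurable for the sources other than [ki i'],
   so the product rule can be used a second time. *)
have hDXX i i' : i != i' ->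
    Rintegrable P (fun x => D i i' x * X (ki i) x * X (ki i') x) /\
    \int[P]_x (D i i' x * X (ki i) x * X (ki i') x) =
    \int[P]_x (D i i' x * X (ki i) x) * (b / n%:R).
  move=> ii'; rewrite -(EX i'); apply: expectation_mul_others => //.
  - apply: meas_othersM; last first.
      by apply: meas_others_coord; rewrite (inj_eq ki_inj).
    by apply: meas_others_sum => j; exact: meas_othersM.
  - exact: iDX.
  - exact: sqintegrable_Rintegrable.
have DXXe i x : D i i x * X (ki i) x * X (ki i) x = D i i x * X (ki i) x.
  by rewrite -mulrA -expr2 X2.
have iDXX i i' : Rintegrable P (fun x => D i i' x * X (ki i) x * X (ki i') x).
  have [<-|/hDXX[]//] := eqVneq i i'.
  by under eq_fun do rewrite DXXe.
(* On the diagonal the square of a 0/1 variable is itself, so only one factor [b / n] appears. *)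
have EDXX i i' : \int[P]_x (D i i' x * X (ki i) x * X (ki i') x) <=
    (b / n%:R) ^+ 2 * tau ^+ 2 + (if i == i' then b / n%:R * tau ^+ 2 else 0).
  have [<-|ii'] := eqVneq i i'.
    under eq_Rintegral do rewrite DXXe.
    rewrite EXD mulrC -[leLHS]add0r; apply: lerD.
      by rewrite mulr_ge0 ?sqr_ge0.
    by rewrite ler_wpM2l.
  have [_ ->] := hDXX _ _ ii'; rewrite EXD addr0 -mulrA -expr2 mulrC.
  by rewrite ler_wpM2l ?sqr_ge0.
have E3 : \sum_j \int[P]_x (S j x ^+ 2) <= b ^+ 2 * tau ^+ 2 + b * tau ^+ 2.
  rewrite -Rexp_sum; last by move=> j; exact: (proj2 (sS j)).
  have -> : (fun x => \sum_j S j x ^+ 2) =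
      (fun x => \sum_i \sum_i' D i i' x * X (ki i) x * X (ki i') x).
    apply/funext => x; rewrite /S /D.
    under eq_bigr do rewrite expr2 mulr_suml.
    rewrite exchange_big; apply: eq_bigr => i _ /=.
    under eq_bigr do rewrite mulr_sumr.
    rewrite exchange_big; apply: eq_bigr => i' _ /=.
    by rewrite !mulr_suml; apply: eq_bigr => j _; ring.
  rewrite Rexp_sum; last by move=> i; exact: Rintegrable_sum.
  (* All [n^2] pairs receive [(b/n)^2 tau^2], and the [n] diagonal pairs an extra [(b/n) tau^2]. *)
  have -> : b ^+ 2 * tau ^+ 2 + b * tau ^+ 2 =
    \sum_(i < n) \sum_(i' < n) ((b / n%:R) ^+ 2 * tau ^+ 2 +
      (if i == i' then b / n%:R * tau ^+ 2 else 0)).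
    have s1 (i : 'I_n) v : \sum_(i' < n) (if i == i' then v else 0 : R) = v.
      rewrite -big_mkcond (big_pred1 i)// => i'; exact: eq_sym.
    under eq_bigr do rewrite big_split/= sumr_const card_ord s1.
    by rewrite sumr_const card_ord; field.
  apply: ler_sum => i _; rewrite Rexp_sum//.
  by apply: ler_sum => i' _.
have -> : (fun x => \sum_j (u j x - eta *
      (b^-1 * (\sum_i X (ki i) x * c i j x) + X (kz j) x)) ^+ 2) =
    (fun x => \sum_j (u j x ^+ 2 - 2 * eta * (u j x * g j x) + eta ^+ 2 * g j x ^+ 2)).
  by apply/funext => x; apply: eq_bigr => j _; rewrite /g /S; ring.
have iu j := proj2 (su j); have ig j := proj2 (sg j).
have iug j := sqintegrable_mul (su j) (sg j).
rewrite Rexp_sum; last first.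
  move=> j; apply: RintegrableD; last exact: RintegrableZ.
  by apply: RintegrableB => //; exact: RintegrableZ.
have Ej j : \int[P]_x (u j x ^+ 2 - 2 * eta * (u j x * g j x) + eta ^+ 2 * g j x ^+ 2)
    <= \int[P]_x (u j x ^+ 2)
    - 2 * eta * \int[P]_x ((n%:R^-1 * \sum_i c i j x) * u j x)
    + eta ^+ 2 * (b ^- 2 * \int[P]_x (S j x ^+ 2) + s2).
  rewrite RintegralD//; last 2 first.
  - by apply: RintegrableB => //; exact: RintegrableZ.
  - exact: RintegrableZ.
  rewrite RintegralB//; [|exact: iu|exact: RintegrableZ].
  rewrite (RintegralZl _ measurableT (iug j)) (RintegralZl _ measurableT (ig j)).
  by rewrite E1 lerD2l ler_wpM2l ?sqr_ge0.
apply: (le_trans (ler_sum _ (fun j _ => Ej j))).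
rewrite !big_split/= sumrN -!mulr_sumr big_split/= -mulr_sumr sumr_const card_ord.
rewrite [X in _ <= X - _ + _]Rexp_sum// [X in _ <= _ - _ * X + _]Rexp_sum; last first.
  move=> j; apply: sqintegrable_mul => //; apply: sqintegrableZ.
  exact: sqintegrable_sum.
rewrite lerD2l ler_wpM2l ?sqr_ge0// (mulr_natl s2 d) lerD2r.
apply: (@le_trans _ _ (b ^- 2 * (b ^+ 2 * tau ^+ 2 + b * tau ^+ 2))).
  by rewrite ler_wpM2l// invr_ge0 sqr_ge0.
have -> : b ^- 2 * (b ^+ 2 * tau ^+ 2 + b * tau ^+ 2) = tau ^+ 2 + b^-1 * tau ^+ 2.
  by field; rewrite gt_eqF.
have : b^-1 * tau ^+ 2 <= tau ^+ 2 by rewrite ler_piMl ?sqr_ge0// invf_le1.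
lra.
Qed.

(** * Iterating the step *)

(** Deterministic core: [m], [N] and [F] stand for the mean squared distance, the mean distance and
    the mean function gap. The hypothesis linking [N] to [m] is Jensen's inequality, in the form the
    induction consumes. *)
Lemma sgd_recursion (R : realType) (m N F : nat -> R) (eta B V D0 C : R) (T : nat) :
  0 < eta -> 0 <= B -> 0 <= V -> 0 <= D0 -> 0 <= C -> (0 < T)%N ->
  eta ^+ 2 * V * T%:R <= 2 * C ^+ 2 ->
  m 0%N = D0 ^+ 2 -> (forall t, 0 <= m t) ->
  (forall t, (t < T)%N -> 0 <= F t) ->
  (forall t a, (t < T)%N -> 0 <= a -> m t <= a ^+ 2 -> N t <= a) ->
  (forall t, (t < T)%N ->
    m t.+1 <= m t - 2 * eta * (F t - B * N t) + eta ^+ 2 * V) ->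
  T%:R^-1 * \sum_(t < T) F t <=
  D0 ^+ 2 / (2 * eta * T%:R) + eta * V / 2
  + B * (eta * B * T%:R / 2 + D0 + C).
Proof.
move=> eta0 B0 V0 D00 C0 T0 hV m0 mge0 F0 hN hm.
have T0' : 0 < T%:R :> R by rewrite ltr0n.
pose s t := Num.sqrt (D0 ^+ 2 + eta ^+ 2 * V * t%:R).
have W0 : 0 <= eta ^+ 2 * V by rewrite mulr_ge0 ?sqr_ge0.
have s2 t : s t ^+ 2 = D0 ^+ 2 + eta ^+ 2 * V * t%:R.
  by rewrite sqr_sqrtr// addr_ge0 ?sqr_ge0// mulr_ge0.
have s0 t : 0 <= s t by exact: sqrtr_ge0.
have eB0 : 0 <= eta * B by rewrite mulr_ge0// ltW.
pose a t := eta * B * t%:R + s t.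
have a0 t : 0 <= a t by rewrite addr_ge0// mulr_ge0.
(* The induction closes because [a t ^+ 2 + 2 eta B (a t) + (eta B)^2] is the square of
   [eta B (t + 1) + s t], and [s t.+1 ^+ 2] absorbs the increment [eta^2 V]. *)
have ma t : (t <= T)%N -> m t <= a t ^+ 2.
  elim: t => [_|t ih tT]; first by rewrite /a mulr0 add0r s2 mulr0 addr0 m0.
  have NtT := hN t _ tT (a0 t) (ih (ltnW tT)).
  have := ih (ltnW tT); have := hm t tT; have := F0 t tT => Ft mt1 mt.
  have sS : s t.+1 ^+ 2 = s t ^+ 2 + eta ^+ 2 * V by rewrite !s2 -natr1; ring.
  have ss : s t <= s t.+1.
    by apply: ler_wsqrtr; rewrite lerD2l ler_wpM2l// ler_nat.
  have h1 : eta * B * N t <= eta * B * a t by exact: ler_wpM2l.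
  have h2 : 0 <= eta * F t by rewrite mulr_ge0// ltW.
  have x0 : 0 <= eta * B * t.+1%:R by rewrite mulr_ge0.
  have h3 : eta * B * t.+1%:R * s t <= eta * B * t.+1%:R * s t.+1.
    exact: ler_wpM2l.
  have e1 : a t.+1 ^+ 2 = (eta * B * t.+1%:R) ^+ 2
      + 2 * (eta * B * t.+1%:R * s t.+1) + s t ^+ 2 + eta ^+ 2 * V.
    by rewrite /a sqrrD sS -mulr_natl; ring.
  have e2 : a t ^+ 2 + 2 * (eta * B * a t) + (eta * B) ^+ 2 =
      (eta * B * t.+1%:R) ^+ 2 + 2 * (eta * B * t.+1%:R * s t) + s t ^+ 2.
    by rewrite /a -natr1; ring.
  have h4 := sqr_ge0 (eta * B).
  have e3 : 2 * eta * (F t - B * N t) = 2 * (eta * F t) - 2 * (eta * B * N t) by ring.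
  rewrite e1; move: mt1; rewrite e3; lra.
(* From [2 y <= (y + 1/2)^2] with [y = t / T]. Unlike the constant bound at [t = T], this affine one
   has mean [C] over the run, which produces the constant in front of [C]. *)
have sC t : (t <= T)%N -> s t <= D0 + C * (t%:R / T%:R + 2^-1).
  move=> tT; set y := t%:R / T%:R.
  have y0 : 0 <= y by rewrite divr_ge0.
  have Cy : 0 <= C * (y + 2^-1) by rewrite mulr_ge0// addr_ge0.
  rewrite -(@ler_pXn2r _ 2%N) ?nnegrE ?addr_ge0// s2.
  have h1 : eta ^+ 2 * V * t%:R <= 2 * C ^+ 2 * y.
    have -> : eta ^+ 2 * V * t%:R = eta ^+ 2 * V * T%:R * y.
      by rewrite /y; field; rewrite gt_eqF.
    exact: ler_wpM2r.
  have h2 : 2 * C ^+ 2 * y <= (C * (y + 2^-1)) ^+ 2.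
    rewrite exprMn mulrAC [leLHS]mulrC ler_wpM2l ?sqr_ge0//.
    by have := sqr_ge0 (y - 2^-1); lra.
  have := mulr_ge0 D00 Cy; rewrite sqrrD; lra.
have NC t : (t < T)%N -> N t <= eta * B * t%:R + (D0 + C * (t%:R / T%:R + 2^-1)).
  move=> tT; apply: (le_trans (hN t _ tT (a0 t) (ma _ (ltnW tT)))).
  by rewrite lerD2l sC// ltnW.
(* The quadratics in [t] dominate the partial sums of [eta B t] and [C (t/T + 1/2)]; at [t = T] they
   equal [eta B T^2 / 2] and [C T]. *)
have key t : (t <= T)%N -> 2 * eta * (\sum_(i < t) F i) + m t <=
    D0 ^+ 2 + 2 * (eta * B) * (eta * B * t%:R ^+ 2 / 2 + D0 * t%:R
      + C * (t%:R ^+ 2 / (2 * T%:R) + t%:R / 2)) + t%:R * (eta ^+ 2 * V).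
  elim: t => [_|t ih tT].
    by rewrite big_ord0 mulr0 add0r m0 expr0n /= !(mul0r, mulr0, addr0).
  rewrite big_ord_recr /= mulrDr -[t.+1%:R]natr1.
  have := ih (ltnW tT); have := hm t tT.
  have h1 := ler_wpM2l eB0 (NC t tT).
  have h2 : 0 <= eta * B * (eta * B) by rewrite mulr_ge0.
  have h3 : 0 <= eta * B * (C / T%:R) by rewrite mulr_ge0// divr_ge0.
  set x := t%:R in h1 *; set z := \sum_(i < t) F i.
  have e1 : C * ((x + 1) ^+ 2 / (2 * T%:R) + (x + 1) / 2) =
     C * (x ^+ 2 / (2 * T%:R) + x / 2) + C * (x / T%:R + 2^-1) + (C / T%:R) / 2.
    by field; rewrite gt_eqF.
  have e2 : eta * B * (x + 1) ^+ 2 / 2 =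
     eta * B * x ^+ 2 / 2 + eta * B * x + eta * B / 2 by field.
  rewrite e1 e2.
  set q1 := C * (x ^+ 2 / (2 * T%:R) + x / 2).
  set q2 := C * (x / T%:R + 2^-1) in h1 *.
  set q3 := C / T%:R in h3 *.
  move: h1 h2 h3; rewrite [2 * eta * (F t - _)](_ : _ = 2 * eta * F t - 2 * (eta * B * N t)); last by ring.
  set NN := eta * B * N t; set e := eta * B; set W := eta ^+ 2 * V.
  rewrite !mulrDr !mulrDl; lra.
have := key T (leqnn T); set z := \sum_(i < T) F i => kT.
have {}kT : 2 * eta * z <= D0 ^+ 2 + 2 * (eta * B) * (eta * B * T%:R ^+ 2 / 2
   + D0 * T%:R + C * (T%:R ^+ 2 / (2 * T%:R) + T%:R / 2)) + T%:R * (eta ^+ 2 * V).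
  by apply: le_trans kT; rewrite lerDl.
have e0 : 0 < 2 * eta * T%:R by rewrite !mulr_gt0.
rewrite -(ler_pM2l e0); apply: le_trans (le_trans kT _).
  by rewrite le_eqVlt; apply/orP; left; apply/eqP; field; rewrite gt_eqF.
rewrite le_eqVlt; apply/orP; left; apply/eqP; field.
by rewrite !gt_eqF.
Qed.

(** Turns the sum over the random batch into a sum over all indices with indicator weights, the form
    required by [sgd_step]. *)
Lemma dpsgd_iter_coordS (R : realType) (d n : nat)
    (g : 'I_n -> 'rV[R]_d -> 'rV[R]_d) w0 (eta b tau : R) (Om : Type)
    (A : nat -> 'I_n -> set Om) (zeta : nat -> 'I_d -> Om -> R) x t j :
  let w := dpsgd_iter g w0 (fun=> eta) b tau (fun t i => x \in A t i)
    (fun t => \row_j zeta t j x) in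
  w t.+1 0 j = w t 0 j - eta * (b^-1 *
    (\sum_(i < n) \1_(A t i) x * clip (g i (w t)) tau 0 j) + zeta t j x).
Proof.
move=> w /=; rewrite -/(w t) !mxE summxE; congr (_ - _ * (_ * _ + _)).
rewrite big_mkcond; apply: eq_bigr => i _; rewrite indicE.
by case: ifP => _; rewrite ?mul1r ?mul0r.
Qed.

(** The measurable space is arbitrary, so it may carry the sigma-algebra of all sources but one.
    Only sources of time [s < t] are constrained, which expresses adaptedness of the iterates. *)
Lemma dpsgd_iter_measurable (R : realType) (d n : nat)
    (g : 'I_n -> 'rV[R]_d -> 'rV[R]_d) w0 (eta b tau : R)
    (dO : measure_display) (Om : measurableType dO)
    (A : nat -> 'I_n -> set Om) (zeta : nat -> 'I_d -> Om -> R) t :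
  (forall (Y : Om -> 'rV[R]_d), (forall j, measurable_fun setT (fun x => Y x 0 j)) ->
    forall i j, measurable_fun setT (fun x => g i (Y x) 0 j)) ->
  (forall s i, (s < t)%N -> measurable_fun setT (\1_(A s i) : Om -> R)) ->
  (forall s j, (s < t)%N -> measurable_fun setT (zeta s j)) ->
  forall j, measurable_fun setT (fun x => dpsgd_iter g w0 (fun=> eta) b tau
    (fun t i => x \in A t i) (fun t => \row_j zeta t j x) t 0 j).
Proof.
move=> mg; elim: t => [|t ih] mA mz j; first exact: measurable_cst.
have {}ih : forall j, measurable_fun setT (fun x => dpsgd_iter g w0 (fun=> eta) b tau
    (fun t i => x \in A t i) (fun t => \row_j zeta t j x) t 0 j).
  by apply: ih => s l st; [apply: mA|apply: mz]; exact: ltnW.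
under eq_fun do rewrite dpsgd_iter_coordS.
apply: measurable_funB; first exact: ih.
apply: measurable_funM => //; apply: measurable_funD; last exact: mz.
apply: measurable_funM => //; apply: measurable_sum => i.
apply: measurable_funM; first exact: mA.
by apply: measurable_clip => l; exact: mg.
Qed.

Lemma normr_coord_le_enorm (R : realType) (d : nat) (z : 'rV[R]_d) j :
  `|z 0 j| <= enorm z.
Proof.
rewrite -sqrtr_sqr; apply: ler_wsqrtr; rewrite (bigD1 j)//= lerDl.
by apply: sumr_ge0 => l _; exact: sqr_ge0.
Qed.

(** * Calculus of the empirical mean *)

Lemma is_derive_mean (R : realType) (d n : nat) (h : 'I_n -> 'rV[R]_d -> R) w v :
  (forall i, differentiable (h i) w) ->
  is_derive w v (fun w => n%:R^-1 * \sum_(i < n) h i w)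
    (n%:R^-1 * \sum_(i < n) 'D_v (h i) w).
Proof.
move=> dh.
have -> : (fun w => n%:R^-1 * \sum_(i < n) h i w) = n%:R^-1 *: \sum_(i < n) h i.
  by apply/funext => x; rewrite /= fct_sumE.
apply: is_deriveZ; apply: is_derive_sum => i.
exact: (DeriveDef (diff_derivable (dh i)) erefl).
Qed.

Lemma differentiable_mean (R : realType) (d n : nat) (h : 'I_n -> 'rV[R]_d -> R) w :
  (forall i, differentiable (h i) w) ->
  differentiable (fun w => n%:R^-1 * \sum_(i < n) h i w) w.
Proof.
move=> dh.
have -> : (fun w => n%:R^-1 * \sum_(i < n) h i w) = n%:R^-1 *: \sum_(i < n) h i.
  by apply/funext => x; rewrite /= fct_sumE.
by apply: differentiableZ; apply: differentiable_sum => i.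
Qed.

Lemma convex_mean_le (R : realType) (d n : nat) (h : 'I_n -> 'rV[R]_d -> R) w v :
  (forall i, differentiable (h i) w) ->
  convex_fun (fun w => n%:R^-1 * \sum_(i < n) h i w) ->
  n%:R^-1 * (\sum_(i < n) h i w) - n%:R^-1 * (\sum_(i < n) h i v) <=
  n%:R^-1 * \sum_(i < n) dotv (grad (h i) w) (w - v).
Proof.
move=> dh ch.
have df := differentiable_mean dh.
apply: (le_trans (convex_le_dotv_grad v ch df)).
rewrite -derive_dotv_grad// (@derive_val _ _ _ _ _ _ _ (is_derive_mean (w - v) dh)).
rewrite le_eqVlt; apply/orP; left; apply/eqP; congr (_ * _).
by apply: eq_bigr => i _; rewrite derive_dotv_grad.
Qed.

Lemma measurable_grad (R : realType) (d : nat) (h : 'rV[R]_d -> R)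
    (dO : measure_display) (Om : measurableType dO) (Y : Om -> 'rV[R]_d) :
  (forall w, differentiable h w) ->
  (forall j, measurable_fun setT (fun x => Y x 0 j)) ->
  forall j, measurable_fun setT (fun x => grad h (Y x) 0 j).
Proof.
move=> dh mY j; under eq_fun do rewrite mxE.
exact: measurable_derive_rV.
Qed.

(** * Risk bound for a fixed dataset *)

Definition dpsgd_sources {R : realType} {dO : measure_display}
    {Om : measurableType dO} {n d : nat} (T : nat) (A : nat -> 'I_n -> set Om)
    (zeta : nat -> 'I_d -> Om -> R) (q : ('I_T * 'I_n + 'I_T * 'I_d)%type) :
    Om -> R :=
  match q with
  | inl p => \1_(A p.1 p.2)
  | inr p => zeta p.1 p.2
  end.

Definition source_time {T n d : nat} (q : ('I_T * 'I_n + 'I_T * 'I_d)%type) :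
    'I_T :=
  match q with inl p => p.1 | inr p => p.1 end.

Lemma dpsgd_risk (R : realType) (d n T : nat) (h : 'I_n -> 'rV[R]_d -> R)
    (Gb : 'I_n -> R) (w0 ws : 'rV[R]_d) (eta b tau s2 B C : R)
    (dO : measure_display) (Om : measurableType dO) (P : probability Om R)
    (A : nat -> 'I_n -> set Om) (zeta : nat -> 'I_d -> Om -> R) :
  let f w := n%:R^-1 * \sum_(i < n) h i w in
  let w t x := dpsgd_iter (fun i => grad (h i)) w0 (fun=> eta) b tau
    (fun t i => x \in A t i) (fun t => \row_j zeta t j x) t in
  (forall i v, differentiable (h i) v) ->
  (forall i v, enorm (grad (h i) v) <= Gb i) ->
  convex_fun f -> (forall v, f ws <= f v) ->
  (0 < n)%N -> (0 < T)%N -> 1 <= b -> 0 < tau -> 0 < eta -> 0 <= C -> 0 <= s2 ->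
  (forall v, n%:R^-1 * \sum_(i < n)
     enorm (grad (h i) v - clip (grad (h i) v) tau) <= B) ->
  mutual_indep P (dpsgd_sources (T := T) A zeta) ->
  (forall (t : 'I_T) i, P (A t i) = (b / n%:R)%:E) ->
  (forall (t : 'I_T) j, sqintegrable P (zeta t j)) ->
  (forall (t : 'I_T) j, \int[P]_x zeta t j x = 0) ->
  (forall (t : 'I_T) j, \int[P]_x (zeta t j x ^+ 2) <= s2) ->
  eta ^+ 2 * (2 * tau ^+ 2 + d%:R * s2) * T%:R <= 2 * C ^+ 2 ->
  ((T%:R^-1)%:E * (\sum_(t < T) \int[P]_x (f (w t x))%:E) - (f ws)%:E <=
   (enorm (w0 - ws) ^+ 2 / (2 * eta * T%:R) + eta * (2 * tau ^+ 2 + d%:R * s2) / 2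
    + B * (eta * B * T%:R / 2 + enorm (w0 - ws) + C))%:E)%E.
Proof.
move=> f w dh hG cf fmin n0 T0 b1 tau0 eta0 C0 s20 hB iX pA sz Ez Ez2 hV.
set X := dpsgd_sources (T := T) A zeta in iX.
have mX := proj1 iX.
have n0' : 0 < n%:R :> R by rewrite ltr0n.
have B0 : 0 <= B.
  apply: (le_trans _ (hB 0)); rewrite mulr_ge0 ?invr_ge0 ?ler0n//.
  by apply: sumr_ge0 => i _; exact: enorm_ge0.
(* The iterate at time [t] uses sources of times below [t] only, so none of them is [q]. *)
have wmo q t : (t <= source_time q)%N -> forall j, meas_others X q (fun x => w t x 0 j).
  move=> tq; apply: (@dpsgd_iter_measurable _ _ _ _ _ _ _ _ _
      (g_sigma_algebraType (sigma_others X q)) A zeta t).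
  - by move=> Y mY i; exact: measurable_grad.
  - move=> s i st; have sT : (s < T)%N.
      by apply: leq_trans (ltn_ord (source_time q)); rewrite ltnS (leq_trans (ltnW st)).
    have := @meas_others_coord _ _ _ _ X q (inl (Ordinal sT, i)); apply.
    by apply/eqP => e; move: tq; rewrite -e /= leqNgt st.
  - move=> s j st; have sT : (s < T)%N.
      by apply: leq_trans (ltn_ord (source_time q)); rewrite ltnS (leq_trans (ltnW st)).
    have := @meas_others_coord _ _ _ _ X q (inr (Ordinal sT, j)); apply.
    by apply/eqP => e; move: tq; rewrite -e /= leqNgt st.
pose u t j x := w t x 0 j - ws 0 j.
pose c t i j x := clip (grad (h i) (w t x)) tau 0 j.
have umo q t j : (t <= source_time q)%N -> meas_others X q (u t j).
  by move=> tq; apply: measurable_funB => //; exact: wmo.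
have cmo q t i j : (t <= source_time q)%N -> meas_others X q (c t i j).
  move=> tq; apply: (@measurable_clip _ _ (g_sigma_algebraType (sigma_others X q))).
  by apply: measurable_grad => // l; exact: wmo.
have clip_le i v : enorm (clip (grad (h i) v) tau) <= tau.
  by rewrite enorm_clip// ge_min lexx orbT.
have cb t i j x : `|c t i j x| <= tau.
  exact: le_trans (normr_coord_le_enorm _ _) (clip_le _ _).
have cc t i i' x : \sum_j c t i j x * c t i' j x <= tau ^+ 2.
  apply: (le_trans (le_dotv_enorm _ _)); rewrite expr2.
  by apply: ler_pM; rewrite ?enorm_ge0.
have uS t j x : u t.+1 j x = u t j x - eta *
    (b^-1 * (\sum_(i < n) \1_(A t i) x * c t i j x) + zeta t j x).
  by rewrite /u /w dpsgd_iter_coordS addrAC.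
have mc (t : 'I_T) i j : measurable_fun setT (c t i j).
  exact: (meas_others_measurable mX (cmo (inr (t, j)) t i j (leqnn _))).
(* Each step adds a bounded clipped term and square-integrable noise, so square-integrability
   propagates. *)
have su t : (t <= T)%N -> forall j, sqintegrable P (u t j).
  elim: t => [_ j|t ih tT j]; first exact: (sqintegrable_cst P (w0 0 j - ws 0 j)).
  have -> : u t.+1 j = (fun x => u t j x + - eta *
    (b^-1 * (\sum_(i < n) \1_(A t i) x * c t i j x) + zeta t j x)).
    by apply/funext => x; rewrite uS mulNr.
  apply: sqintegrableD; first by apply: ih; exact: ltnW.
  apply: sqintegrableZ; apply: sqintegrableD; last exact: (sz (Ordinal tT)).
  apply: sqintegrableZ; apply: sqintegrable_sum => i.
  apply: (@sqintegrable_bounded _ _ _ _ tau).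
    apply: measurable_funM; last exact: (mc (Ordinal tT)).
    exact: (mX (inl (Ordinal tT, i))).
  move=> x; rewrite normrM -[leRHS]mul1r; apply: ler_pM => //.
  by rewrite indicE; case: (_ \in _); rewrite ?normr1 ?normr0.
pose m t := \int[P]_x (\sum_j u t j x ^+ 2).
pose N t := \int[P]_x enorm (w t x - ws).
pose F t := \int[P]_x (f (w t x) - f ws).
have enE t x : enorm (w t x - ws) ^+ 2 = \sum_j u t j x ^+ 2.
  by rewrite enorm_sqr; apply: eq_bigr => j _; rewrite !mxE expr2.
have sN t : (t < T)%N -> sqintegrable P (fun x => enorm (w t x - ws)).
  move=> tT; split.
    apply: measurable_enorm => j; under eq_fun do rewrite !mxE.
    exact: (proj1 (su t (ltnW tT) j)).
  under eq_fun do rewrite enE.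
  by apply: Rintegrable_sum => j; exact: (proj2 (su t (ltnW tT) j)).
(* A linear growth bound from the unclipped gradients; it yields integrability of the function
   gap. *)
have fub v : f v - f ws <= n%:R^-1 * (\sum_i Gb i) * enorm (v - ws).
  apply: (le_trans (convex_mean_le _ (fun i => dh i v) cf)).
  rewrite -mulrA ler_wpM2l ?invr_ge0// mulr_suml; apply: ler_sum => i _.
  apply: (le_trans (le_dotv_enorm _ _)).
  by rewrite ler_wpM2r ?enorm_ge0.
have cf' : continuous f.
  by move=> v; apply: differentiable_continuous; exact: differentiable_mean.
have iF t : (t < T)%N -> Rintegrable P (fun x => f (w t x) - f ws).
  move=> tT.
  apply: Rintegrable_le (RintegrableZ (n%:R^-1 * (\sum_i Gb i))
    (sqintegrable_Rintegrable (sN t tT))).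
    apply: measurable_funB => //; apply: measurable_continuous_rV => // j.
    have -> : (fun x => w t x 0 j) = (fun x => u t j x + ws 0 j).
      by apply/funext => x; rewrite subrK.
    by apply: measurable_funD => //; exact: (proj1 (su t (ltnW tT) j)).
  move=> x; rewrite ger0_norm ?subr_ge0//.
  by apply: le_trans (ler_norm _).
(* Convexity combined with Cauchy-Schwarz on the clipping error: the bias costs at most [B] times
   the distance. *)
have lower t x : f (w t x) - f ws - B * enorm (w t x - ws) <=
    \sum_j (n%:R^-1 * \sum_i c t i j x) * u t j x.
  rewrite lerBlDr; apply: (le_trans (convex_mean_le _ (fun i => dh i _) cf)).
  apply: (@le_trans _ _ (\sum_j n%:R^-1 * (\sum_i c t i j x) * u t j x +
     n%:R^-1 * (\sum_i enorm (grad (h i) (w t x) - clip (grad (h i) (w t x)) tau))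
       * enorm (w t x - ws))); last first.
    by rewrite lerD2l ler_wpM2r ?enorm_ge0.
  have -> : \sum_j n%:R^-1 * (\sum_i c t i j x) * u t j x =
      n%:R^-1 * \sum_i dotv (clip (grad (h i) (w t x)) tau) (w t x - ws).
    under eq_bigr do rewrite -mulrA; rewrite -mulr_sumr; congr (_ * _).
    under eq_bigr do rewrite mulr_suml.
    rewrite exchange_big; apply: eq_bigr => i _; apply: eq_bigr => j _.
    by have -> : (w t x - ws) 0 j = u t j x by rewrite !mxE.
  rewrite -mulrA -mulrDr ler_wpM2l ?invr_ge0// mulr_suml -big_split/=.
  apply: ler_sum => i _; rewrite -lerBlDl -dotvBl.
  exact: le_dotv_enorm.
have step t : (t < T)%N -> m t.+1 <= m t - 2 * eta * (F t - B * N t)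
    + eta ^+ 2 * (2 * tau ^+ 2 + d%:R * s2).
  move=> tT; pose t' := Ordinal tT.
  have := @sgd_step _ _ _ P _ X n d (fun i => inl (t', i)) (fun j => inr (t', j))
    b tau s2 eta (u t) (c t) iX.
  have hX2 i x : (\1_(A t i) x : R) ^+ 2 = \1_(A t i) x.
    by rewrite indicE; case: (_ \in _); rewrite ?expr1n ?expr0n.
  have hEX i : \int[P]_x (\1_(A t i) x : R) = b / n%:R.
    have mA : measurable (A t i).
      by apply/measurable_indicP; exact: (mX (inl (t', i))).
    have e : P (A t i) = (b / n%:R)%:E := pA t' i.
    by apply: (congr1 fine (etrans _ e)); rewrite integral_indic// setIT.
  move=> /(_ _ _ hX2 hEX (sz t') (Ez t') (Ez2 t')) H.
  (* Injectivity of [ki] comes from projecting out of the sum type; the default [i] only makes the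
     projection total. *)
  have {}H := H (fun i i' e => congr1 (fun q => if q is inl p then p.2 else i) e)
     (fun i j => isT)
     (fun i j => umo (inl (t', i)) t j (leqnn t))
     (fun j => umo (inr (t', j)) t j (leqnn t))
     (fun i i' j => cmo (inl (t', i)) t i' j (leqnn t))
     (fun i j => cmo (inr (t', j)) t i j (leqnn t))
     (su t (ltnW tT)) (cb t) (cc t) n0 b1.
  rewrite /m; under eq_Rintegral do under eq_bigr do rewrite uS.
  apply: (le_trans H); rewrite lerD2r lerD2l lerN2 ler_wpM2l ?mulr_ge0// ?(ltW eta0)//.
  have iN := sqintegrable_Rintegrable (sN t tT).
  rewrite /F /N -RintegralZl// -RintegralB//; last 2 first.
  - exact: iF.
  - exact: RintegrableZ.
  apply: le_Rintegral => //.
  - by apply: RintegrableB; [exact: iF|exact: RintegrableZ].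
  - apply: Rintegrable_sum => j; apply: sqintegrable_mul; last exact: su (ltnW tT) _.
    apply: sqintegrableZ; apply: sqintegrable_sum => i.
    by apply: (@sqintegrable_bounded _ _ _ _ tau); [exact: (mc t')|exact: cb].
have F0 t : (t < T)%N -> 0 <= F t.
  by move=> _; apply: Rintegral_ge0 => x _; rewrite subr_ge0.
have V0 : 0 <= 2 * tau ^+ 2 + d%:R * s2.
  by apply: addr_ge0; apply: mulr_ge0 => //; exact: sqr_ge0.
have NX t a : (t < T)%N -> 0 <= a -> m t <= a ^+ 2 -> N t <= a.
  move=> tT a0 ma; apply: Rexp_le_sqr => //; first exact: sN.
  by under eq_Rintegral do rewrite enE.
have m0E : m 0%N = enorm (w0 - ws) ^+ 2.
  transitivity (\int[P]_x (enorm (w0 - ws) ^+ 2)); last exact: Rexp_cst.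
  by apply: eq_Rintegral => x _; rewrite -enE.
have mge0 t : 0 <= m t.
  by apply: Rintegral_ge0 => x _; apply: sumr_ge0 => j _; exact: sqr_ge0.
have := sgd_recursion eta0 B0 V0 (enorm_ge0 _) C0 T0 hV m0E mge0 F0 NX step.
(* The risk is stated with extended-real integrals; integrability of the gap makes them finite, so
   the comparison can be made in [R]. *)
have intf t : (t < T)%N -> (\int[P]_x (f (w t x))%:E = (F t + f ws)%:E)%E.
  move=> tT; have ifw : Rintegrable P (fun x => f (w t x)).
    have := RintegrableD (iF t tT) (Rintegrable_cst P (f ws)).
    by under eq_fun do rewrite subrK.
  have -> : F t + f ws = \int[P]_x f (w t x).
    rewrite /F RintegralB// ?Rexp_cst ?subrK//.
    exact: Rintegrable_cst.
  by rewrite /Rintegral fineK//; exact: integrable_fin_num.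
have -> : (\sum_(t < T) \int[P]_x (f (w t x))%:E =
    \sum_(t < T) (F t + f ws)%:E)%E.
  by apply: eq_bigr => t _; exact: intf.
rewrite sumEFin -EFinM -EFinB lee_fin; apply: le_trans.
rewrite big_split/= sumr_const card_ord mulrDr -[f ws *+ T]mulr_natl.
by rewrite [_ * (T%:R * _)]mulrA mulVf ?mul1r ?addrK// pnatr_eq0 -lt0n.
Qed.

(** * Random datasets and parameter choice *)

Lemma ge0_integral_law (R : realType) (dO dS : measure_display)
    (Om : measurableType dO) (S : measurableType dS) (P : probability Om R)
    (mu : probability S R) (X : Om -> S) (g : S -> \bar R) :
  measurable_fun setT X -> (forall B, measurable B -> P (X @^-1` B) = mu B) ->
  measurable_fun setT g -> (forall s, 0 <= g s)%E ->
  (\int[P]_x g (X x) = \int[mu]_s g s)%E.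
Proof.
move=> mX law mg g0; pose X1 := mfun_Sub (mem_set mX : X \in mfun).
rewrite -(@ge0_integral_distribution _ _ _ _ _ P X1)//.
by apply: eq_measure_integral => B mB _; exact: law.
Qed.

Lemma integral_law (R : realType) (dO dS : measure_display)
    (Om : measurableType dO) (S : measurableType dS) (P : probability Om R)
    (mu : probability S R) (X : Om -> S) (g : S -> \bar R) :
  measurable_fun setT X -> (forall B, measurable B -> P (X @^-1` B) = mu B) ->
  mu.-integrable setT g ->
  P.-integrable setT (g \o X) /\ (\int[P]_x g (X x) = \int[mu]_s g s)%E.
Proof.
move=> mX law ig; have mg := measurable_int _ ig.
pose X1 := mfun_Sub (mem_set mX : X \in mfun).
have iX : P.-integrable setT (g \o X).
  apply/integrableP; split; first exact: measurableT_comp.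
  have -> : (\int[P]_x `|(g \o X) x| = \int[mu]_s `|g s|)%E.
    by apply: (ge0_integral_law (g := fun s => `|g s|%E)) => //; exact: measurableT_comp.
  by case/integrableP : ig.
split => //; transitivity (\int[distribution P X1]_s g s)%E.
  by rewrite integral_distribution.
by apply: eq_measure_integral => B mB _; exact: law.
Qed.

Lemma normal_law_moments (R : realType) (dO : measure_display)
    (Om : measurableType dO) (P : probability Om R) (X : Om -> R) (s : R) :
  0 < s -> measurable_fun setT X ->
  (forall B, measurable B -> P (X @^-1` B) = normal_prob 0 s B) ->
  [/\ sqintegrable P X, \int[P]_x X x = 0 & \int[P]_x (X x ^+ 2) <= s ^+ 2].
Proof.
move=> s0 mX law.
have [i1 e1] := @integral_law _ _ _ _ _ P (normal_prob 0 s) X _ mX law (normal_integrable_id s0).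
have [i2 e2] := @integral_law _ _ _ _ _ P (normal_prob 0 s) X _ mX law (normal_integrable_sqr s0).
split; first by split.
- by rewrite /Rintegral e1 normal_mean.
- rewrite -lee_fin /Rintegral fineK ?e2 ?normal_second_moment//.
  exact: integrable_fin_num (normal_integrable_sqr s0).
Qed.

(** Raising the norm bound to the power [k] in the extended reals also shows that the moment is
    finite. *)
Lemma moment_le_powR (R : realType) (dS : measure_display)
    (S : measurableType dS) (D : probability S R) (Gf : S -> R) (k Gc : R) :
  1 < k -> 0 < Gc -> ((\int[D]_s ((Gf s) `^ k)%:E) `^ k^-1 <= Gc%:E)%E ->
  (\int[D]_s ((Gf s) `^ k)%:E <= (Gc `^ k)%:E)%E.
Proof.
move=> k1 Gc0 h; have k0 : 0 < k by lra.
have I0 : (0 <= \int[D]_s ((Gf s) `^ k)%:E)%E.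
  by apply: integral_ge0 => s _; rewrite lee_fin powR_ge0.
have := gt0_ler_poweR (ltW k0) _ _ h.
rewrite -poweRrM mulVf ?gt_eqF// poweRe1// poweR_EFin; apply.
- by rewrite in_itv/= leey poweR_ge0.
- by rewrite in_itv/= leey lee_fin ltW.
Qed.

Lemma markov_ge0 (R : realType) (dO : measure_display)
    (Om : measurableType dO) (P : probability Om R) (Y : Om -> R) (a : R) :
  measurable_fun setT Y -> (forall x, 0 <= Y x) -> 0 <= a ->
  (a%:E * P [set x | a < Y x]%R <= \int[P]_x (Y x)%:E)%E.
Proof.
move=> mY Y0 a0.
have mA : measurable [set x | a < Y x].
  rewrite -[X in measurable X]setTI.
  have -> : [set x | a < Y x] = Y @^-1` `]a, +oo[.
    by apply/seteqP; split => x /=; rewrite in_itv/= andbT.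
  exact: mY.
have -> : (a%:E * P [set x | a < Y x]%R =
    \int[P]_x (a * \1_[set x | a < Y x]%R x)%:E)%E.
  under eq_integral do rewrite EFinM.
  rewrite ge0_integralZl_EFin//; last exact/measurable_EFinP/measurable_indic.
  by rewrite integral_indic// setIT.
apply: ge0_le_integral => //.
- by move=> x _; rewrite lee_fin mulr_ge0.
- by apply/measurable_EFinP/measurable_funM => //; exact: measurable_indic.
- exact/measurable_EFinP.
- move=> x _; rewrite lee_fin indicE; case: (boolP (_ \in _)) => [|_].
    by rewrite inE mulr1 => /ltW.
  by rewrite mulr0.
Qed.

(** The excluded event is the union of the Markov event, of probability at most [gamma], and the
    null event that some sample hits the exceptional set [N] of [Q]. *)
Lemma empirical_moment_event (R : realType) (dS : measure_display)
    (S : measurableType dS) (D : probability S R) (n : nat) (Gf : S -> R)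
    (Q : set S) (k Gc gamma : R) (dO : measure_display) (Om : measurableType dO)
    (P : probability Om R) (Z : 'I_n -> Om -> S) :
  measurable_fun setT Gf -> {ae D, forall s, Q s} -> 1 < k -> 0 < Gc ->
  ((\int[D]_s ((Gf s) `^ k)%:E) `^ k^-1 <= Gc%:E)%E -> (0 < n)%N ->
  (forall i, measurable_fun setT (Z i)) ->
  (forall i B, measurable B -> P (Z i @^-1` B) = D B) -> 0 < gamma ->
  exists E : set Om, [/\ measurable E, ((1 - gamma)%:E <= P E)%E &
    forall om, E om -> (forall i, Q (Z i om)) /\
      n%:R^-1 * (\sum_(i < n) Gf (Z i om) `^ k) <= Gc `^ k / gamma].
Proof.
move=> mG [N [mN N0 QN]] k1 Gc0 hI n0 mZ law gamma0.
have n0' : 0 < n%:R :> R by rewrite ltr0n.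
pose Y om := n%:R^-1 * (\sum_(i < n) Gf (Z i om) `^ k).
have mGZ i : measurable_fun setT (fun om => Gf (Z i om) `^ k).
  by apply: (measurableT_comp (measurable_powR k)); exact: measurableT_comp.
have mY : measurable_fun setT Y by apply: measurable_funM => //; exact: measurable_sum.
have Y0 om : 0 <= Y om.
  by rewrite mulr_ge0 ?invr_ge0// sumr_ge0// => i _; exact: powR_ge0.
pose a := Gc `^ k / gamma.
have Gk0 : 0 < Gc `^ k by exact: powR_gt0.
have a0 : 0 < a by rewrite divr_gt0.
have EY : (\int[P]_x (Y x)%:E <= (Gc `^ k)%:E)%E.
  rewrite /Y; under eq_integral do rewrite EFinM -sumEFin.
  rewrite ge0_integralZl_EFin ?invr_ge0//; last 2 first.
  - by move=> om _; apply: sume_ge0 => i _; rewrite lee_fin powR_ge0.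
  - by apply: emeasurable_sum => i; exact/measurable_EFinP.
  have mF i : measurable_fun setT (fun om => (Gf (Z i om) `^ k)%:E).
    exact/measurable_EFinP.
  have F0 i om : setT om -> (0 <= (Gf (Z i om) `^ k)%:E)%E.
    by rewrite lee_fin powR_ge0.
  rewrite (ge0_integral_sum P measurableT mF F0).
  have e i : (\int[P]_om (Gf (Z i om) `^ k)%:E = \int[D]_s (Gf s `^ k)%:E)%E.
    apply: (ge0_integral_law (g := fun s => (Gf s `^ k)%:E)) => //.
    - by move=> B mB; exact: law.
    - by apply/measurable_EFinP; apply: (measurableT_comp (measurable_powR k)).
    - by move=> s; rewrite lee_fin powR_ge0.
  under eq_bigr do rewrite e.
  have h := moment_le_powR k1 Gc0 hI.
  apply: (@le_trans _ _ ((n%:R^-1)%:E * (\sum_(i < n) (Gc `^ k)%:E))%E).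
    by apply: lee_wpmul2l; [rewrite lee_fin invr_ge0|exact: lee_sum].
  rewrite sumEFin -EFinM lee_fin sumr_const card_ord -[Gc `^ k *+ n]mulr_natl.
  by rewrite mulrA mulVf ?mul1r// gt_eqF.
pose U := [set om | a < Y om].
have mU : measurable U.
  rewrite -[X in measurable X]setTI.
  have -> : U = Y @^-1` `]a, +oo[.
    by apply/seteqP; split => x /=; rewrite in_itv/= andbT.
  exact: mY.
have PU : (P U <= gamma%:E)%E.
  have := le_trans (markov_ge0 P mY Y0 (ltW a0)) EY.
  rewrite -/U -[P U]fineK ?fin_num_measure// -EFinM !lee_fin => h.
  by rewrite -(ler_pM2l a0) (le_trans h)// /a divfK// gt_eqF.
(* Indexed by a list, so that nullity follows by induction and subadditivity. *)
pose W (l : seq 'I_n) := [set om | exists2 i, i \in l & N (Z i om)].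
have mZN i : measurable (Z i @^-1` N).
  by rewrite -[X in measurable X]setTI; exact: mZ.
have [mW PW] : measurable (W (enum 'I_n)) /\ P (W (enum 'I_n)) = 0%E.
  elim: (enum 'I_n) => [|i l [mW PW]].
    have -> : W [::] = set0 by apply/seteqP; split => // om [].
    by rewrite measure0.
  have -> : W (i :: l) = Z i @^-1` N `|` W l.
    apply/seteqP; split => om /=.
      by move=> [i']; rewrite inE => /orP[/eqP ->|i'l]; [left|right; exists i'].
    by case=> [Ni|[i' i'l Ni]]; [exists i|exists i'] => //;
      rewrite inE ?eqxx// i'l orbT.
  split; first exact: measurableU.
  apply/eqP; rewrite eq_le measure_ge0 andbT.
  apply: le_trans (measureU2 _ (mZN i) mW) _.
  by rewrite [X in (_ + X)%E]PW [X in (X + _)%E](law i N mN) N0 adde0.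
exists (~` (W (enum 'I_n) `|` U)); split.
- by apply: measurableC; exact: measurableU.
- rewrite probability_setC; last exact: measurableU.
  have -> : (1 - gamma)%:E = (1 - gamma%:E)%E :> \bar R by rewrite EFinB.
  apply: leeB => //; apply: le_trans (measureU2 _ mW mU) _.
  by rewrite [X in (X + _)%E]PW add0e.
- move=> om; rewrite setCU => -[Wom Uom]; split.
    move=> i; apply: contrapT => nQ; apply: Wom; exists i; first by rewrite mem_enum.
    exact: QN.
  by rewrite leNgt; apply/negP.
Qed.

(* Young's inequality with [b = 1] linearizes the power mean inequality. *)
Lemma mean_le_of_powR_mean (R : realType) (n : nat) (x : 'I_n -> R) (k c : R) :
  (0 < n)%N -> 1 < k -> 0 < c -> (forall i, 0 <= x i) ->
  n%:R^-1 * (\sum_(i < n) x i `^ k) <= c `^ k ->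
  n%:R^-1 * (\sum_(i < n) x i) <= c.
Proof.
move=> n0 k1 c0 x0 h.
have k0 : 0 < k by lra.
have n0' : 0 < n%:R :> R by rewrite ltr0n.
have ck0 : 0 < c `^ k by exact: powR_gt0.
have q0 : 0 < k / (k - 1) by rewrite divr_gt0 ?subr_gt0.
have pq : k^-1 + (k / (k - 1))^-1 = 1.
  by field; rewrite !gt_eqF ?subr_gt0.
have Y i : x i <= c * (x i `^ k / (c `^ k * k) + (1 - k^-1)).
  have := conjugate_powR (divr_ge0 (x0 i) (ltW c0)) ler01 k0 q0 pq.
  rewrite mulr1 powR1 mul1r powRM ?invr_ge0 ?(ltW c0)//.
  have -> : c^-1 `^ k = (c `^ k)^-1.
    by rewrite -(powR_inv1 (ltW c0)) -powRrM mulN1r powRN.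
  have -> : (k / (k - 1))^-1 = 1 - k^-1 by apply/esym/eqP; rewrite subr_eq addrC pq.
  rewrite ler_pdivrMr// => /le_trans; apply; rewrite mulrC.
  by rewrite ler_wpM2l ?(ltW c0)// invfM mulrA.
apply: (@le_trans _ _ (n%:R^-1 * \sum_(i < n)
    c * (x i `^ k / (c `^ k * k) + (1 - k^-1)))).
  by rewrite ler_wpM2l ?invr_ge0//; apply: ler_sum => i _.
rewrite -mulr_sumr big_split/= -mulr_suml sumr_const card_ord.
rewrite -[(1 - k^-1) *+ n]mulr_natl.
have -> : n%:R^-1 * (c * ((\sum_(i < n) x i `^ k) / (c `^ k * k) +
    n%:R * (1 - k^-1))) =
    c * ((n%:R^-1 * \sum_(i < n) x i `^ k) / (c `^ k * k) + (1 - k^-1)).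
  by field; rewrite !gt_eqF.
rewrite -[leRHS]mulr1 ler_wpM2l ?(ltW c0)//.
rewrite -lerBrDr opprB addrCA subrr addr0 ler_pdivrMr ?mulr_gt0//.
by rewrite mulrCA mulVf ?mulr1// gt_eqF.
Qed.

(** The step size makes the initial-distance, variance and drift terms all multiples of
    [tau * r = Gp * y]. Variance contributes [C] and drift [C / 2], together below the [2 C] of the
    bound. *)
Lemma dpsgd_tuning (R : realType) (Gp tau r y N C D0 B V : R) :
  0 < Gp -> 0 < tau -> 0 < r -> 0 < y -> 0 < N -> 0 < C -> 0 <= D0 -> 0 <= B ->
  tau * r = Gp * y -> B <= Gp -> B <= Gp * y ^+ 2 ->
  V <= 2 * tau ^+ 2 * (N * r ^+ 2) ->
  let eta := C / (N * tau) * r^-1 in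
  eta ^+ 2 * V * N <= 2 * C ^+ 2 /\
  D0 ^+ 2 / (2 * eta * N) + eta * V / 2 + B * (eta * B * N / 2 + D0 + C) <=
  Gp * (2^-1 * (D0 ^+ 2 / C + 4 * C) * y + (D0 + C) * y ^+ 2).
Proof.
move=> Gp0 tau0 r0 y0 N0 C0 D00 B0 try BG BGy VV eta.
have nz : [/\ tau != 0, r != 0, N != 0 & C != 0] by rewrite !gt_eqF.
have [tz rz Nz Cz] := nz.
have eta0 : 0 < eta by rewrite /eta !(mulr_gt0, divr_gt0, invr_gt0).
split.
  apply: (@le_trans _ _ (eta ^+ 2 * (2 * tau ^+ 2 * (N * r ^+ 2)) * N)).
    by rewrite ler_wpM2r ?(ltW N0)// ler_wpM2l// sqr_ge0.
  by rewrite le_eqVlt; apply/orP; left; apply/eqP; rewrite /eta; field; rewrite tz rz Nz.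
have e1 : D0 ^+ 2 / (2 * eta * N) = D0 ^+ 2 / (2 * C) * (Gp * y).
  by rewrite -try /eta; field; rewrite tz rz Nz Cz.
have e2 : eta * V / 2 <= C * (Gp * y).
  apply: (@le_trans _ _ (eta * (2 * tau ^+ 2 * (N * r ^+ 2)) / 2)).
    by rewrite ler_wpM2r ?invr_ge0// ler_wpM2l// ltW.
  by rewrite -try le_eqVlt; apply/orP; left; apply/eqP; rewrite /eta; field; rewrite tz rz Nz.
(* Multiplying the two bounds on [B] gives [Gp^2 y^2], whatever the size of [y]. *)
have BB : B ^+ 2 <= (tau * r) ^+ 2.
  have -> : (tau * r) ^+ 2 = Gp * (Gp * y ^+ 2) by rewrite try; ring.
  by rewrite expr2; exact: ler_pM.
have e3 : B * (eta * B * N / 2) <= C / 2 * (Gp * y).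
  have -> : B * (eta * B * N / 2) = B ^+ 2 * (C / (2 * tau * r)).
    by rewrite /eta; field; rewrite tz rz Nz.
  apply: (@le_trans _ _ ((tau * r) ^+ 2 * (C / (2 * tau * r)))).
    by rewrite ler_wpM2r// divr_ge0 ?(ltW C0)// !mulr_ge0// ltW.
  by rewrite -try le_eqVlt; apply/orP; left; apply/eqP; field; rewrite tz rz.
have e4 : B * (D0 + C) <= Gp * y ^+ 2 * (D0 + C).
  by rewrite ler_wpM2r// addr_ge0// ltW.
have e5 : 0 <= C * (Gp * y) by rewrite !mulr_ge0// ltW.
have e6 : Gp * (2^-1 * (D0 ^+ 2 / C + 4 * C) * y + (D0 + C) * y ^+ 2) =
    D0 ^+ 2 / (2 * C) * (Gp * y) + 2 * (C * (Gp * y)) + Gp * y ^+ 2 * (D0 + C).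
  by field.
rewrite e6 e1 -addrA [B * _]mulrDr [B * (_ + D0)]mulrDr.
have e7 : B * (D0 + C) = B * D0 + B * C by ring.
move: e3 e4; rewrite e7 (_ : C / 2 * (Gp * y) = C * (Gp * y) / 2); last by field.
lra.
Qed.

Lemma powR_scaling_split (R : realType) (K k : R) : 0 < K -> 1 < k ->
  [/\ K `^ (- 2^-1) = (K `^ 2^-1)^-1, (K `^ 2^-1) ^+ 2 = K,
      K `^ (- (k + 1)^-1) * K `^ 2^-1 = K `^ (2^-1 * (1 - 2 / (k + 1))),
      (K `^ (2^-1 * (1 - 2 / (k + 1)))) ^+ 2 = K `^ (1 - 2 / (k + 1)) &
      (K `^ (- (k + 1)^-1)) `^ (1 - k) = K `^ (1 - 2 / (k + 1))].
Proof.
move=> K0 k1.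
have k1' : k + 1 != 0 by rewrite gt_eqF//; lra.
have Kz (r : R) : (r == 0) ==> (K != 0) by rewrite (gt_eqF K0) implybT.
split.
- by rewrite powRN.
- by rewrite -powR_mulrn ?powR_ge0// -powRrM mulVf ?pnatr_eq0// powRr1// ltW.
- by rewrite -powRD//; congr (_ `^ _); field.
- by rewrite -powR_mulrn ?powR_ge0// -powRrM; congr (_ `^ _); field.
- by rewrite -powRrM; congr (_ `^ _); field.
Qed.

Lemma powR_double_sqr (R : realType) (phi k : R) : 0 < phi -> 1 < k ->
  let K := 2 * phi ^+ 2 in
  [/\ 2^-1 * K `^ (2^-1 * (1 - 2 / (k + 1))) =
        (2 `^ (2^-1 + (k + 1)^-1))^-1 * phi `^ (1 - 2 / (k + 1)) &
      K `^ (1 - 2 / (k + 1)) =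
        2 `^ (1 - 2 / (k + 1)) * phi `^ (2 * (1 - 2 / (k + 1)))].
Proof.
move=> phi0 k1 K.
have k1' : k + 1 != 0 by rewrite gt_eqF//; lra.
have KE r : K `^ r = 2 `^ r * phi `^ (2 * r).
  by rewrite /K powRM ?sqr_ge0// -powR_mulrn ?(ltW phi0)// -powRrM.
split; last by rewrite KE.
rewrite KE mulrA; congr (_ * _); last by congr (_ `^ _); field.
rewrite -powRN -{1}(@powR_inv1 _ 2)// -powRD; last by apply/implyP.
by congr (_ `^ _); field.
Qed.

(** * High-probability bound over the dataset *)

Unset Implicit Arguments.

Theorem mainTheorem3
  (R : realType)
  (* sample space and data distribution D *)
  (dS : measure_display) (S : measurableType dS) (D : probability S R)
  (d n : nat) (loss : 'rV[R]_d -> S -> R)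
  (Gf : S -> R) (k Gc : R)
  (* probability space carrying the random dataset Z = (Z_i)_{i<n} *)
  (dO0 : measure_display) (Om0 : measurableType dO0) (P0 : probability Om0 R)
  (Z : 'I_n -> Om0 -> S) (wstar : Om0 -> 'rV[R]_d)
  (* privacy / algorithm parameters *)
  (eps delta nu b gamma C : R) (T : nat) (w0 : 'rV[R]_d)
  (* probability space carrying the algorithm's randomness *)
  (dO1 : measure_display) (Om1 : measurableType dO1) (P1 : probability Om1 R)
  (A : nat -> 'I_n -> set Om1) (zeta : nat -> 'I_d -> Om1 -> R) :
  (* loss, gradient bound, moment bound *)
  (forall s w, differentiable (fun v => loss v s) w) ->
  measurable_fun setT Gf ->
  (forall s, 0 <= Gf s) ->
  {ae D, forall s, forall w, enorm (grad (fun v => loss v s) w) <= Gf s} ->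
  1 < k -> 0 < Gc ->
  ((\int[D]_s ((Gf s) `^ k)%:E) `^ k^-1 <= Gc%:E)%E ->
  (* i.i.d. dataset *)
  (0 < n)%N ->
  mutual_indep P0 Z ->
  (forall i B, measurable B -> P0 (Z i @^-1` B) = D B) ->
  (* f convex with minimizer w*, for every realization of the dataset *)
  (forall om, convex_fun (fun w => n%:R^-1 * \sum_(i < n) loss w (Z i om))) ->
  (forall om w, n%:R^-1 * \sum_(i < n) loss (wstar om) (Z i om)
                <= n%:R^-1 * \sum_(i < n) loss w (Z i om)) ->
  (* parameters *)
  0 < eps -> 0 < delta < 1 -> 0 < nu -> 1 <= b ->
  0 < gamma < 1 -> 0 < C -> (1 <= T)%N ->
  let phi := Num.sqrt (nu * d%:R * ln (delta^-1)) / (n%:R * eps) in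
  let tau := Gc / gamma `^ k^-1 * (T%:R^-1 + phi ^+ 2) `^ (- (k + 1)^-1) in
  let eta := C / (T%:R * tau) * (T%:R^-1 + phi ^+ 2) `^ (- 2^-1) in
  let sigma2 := nu * T%:R * ln (delta^-1) * tau ^+ 2 / (n%:R ^+ 2 * eps ^+ 2) in
  (* algorithm randomness: Poisson subsampling events and Gaussian noise,
     all mutually independent *)
  mutual_indep P1 (fun kk : ('I_T * 'I_n + 'I_T * 'I_d)%type =>
    match kk with
    | inl p => \1_(A p.1 p.2) : Om1 -> R
    | inr p => zeta p.1 p.2
    end) ->
  (forall (t : 'I_T) i, P1 (A t i) = (b / n%:R)%:E) ->
  (forall (t : 'I_T) j B, measurable B ->
     P1 (zeta t j @^-1` B) = normal_prob 0 (Num.sqrt sigma2) B) ->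
  let f om w := n%:R^-1 * \sum_(i < n) loss w (Z i om) in
  let w om t x := dpsgd_iter (fun i => grad (fun v => loss v (Z i om))) w0
                    (fun _ => eta) b tau (fun t i => x \in A t i)
                    (fun t => \row_(j < d) zeta t j x) t in
  let OR om := ((T%:R^-1)%:E * (\sum_(t < T) \int[P1]_x (f om (w om t x))%:E)
                 - (f om (wstar om))%:E)%E in
  let D0 om := enorm (w0 - wstar om) in
  (exists E : set Om0, measurable E /\ ((1 - gamma)%:E <= P0 E)%E /\
     forall om, E om ->
       (OR om <= (Gc / gamma `^ k^-1 *
          (2^-1 * (D0 om ^+ 2 / C + 4 * C)
             * (T%:R^-1 + phi ^+ 2) `^ (2^-1 * (1 - 2 / (k + 1)))
           + (D0 om + C) * (T%:R^-1 + phi ^+ 2) `^ (1 - 2 / (k + 1))))%:E)%E)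
  /\
  (T%:R = (phi ^+ 2)^-1 ->
   exists E : set Om0, measurable E /\ ((1 - gamma)%:E <= P0 E)%E /\
     forall om, E om ->
       (OR om <= (Gc / gamma `^ k^-1 *
          ((2 `^ (2^-1 + (k + 1)^-1))^-1 * (D0 om ^+ 2 / C + 4 * C)
             * phi `^ (1 - 2 / (k + 1))
           + 2 `^ (1 - 2 / (k + 1)) * (D0 om + C)
             * phi `^ (2 * (1 - 2 / (k + 1)))))%:E)%E).
Proof.
move=> dl mG G0 aeG k1 Gc0 mom n0 indZ lawZ cf fmin eps0 delta01 nu0 b1 gamma01 C0 T0.
move=> phi tau eta sigma2 indA pA lawz f w OR D0.
have k1' : k + 1 != 0 by rewrite gt_eqF//; lra.
have k0 : k != 0 by rewrite gt_eqF//; lra.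
have [gamma0 gamma1] : 0 < gamma /\ gamma < 1 by case/andP: gamma01.
have [delta0 delta1] : 0 < delta /\ delta < 1 by case/andP: delta01.
have n0' : 0 < n%:R :> R by rewrite ltr0n.
have T0' : 0 < T%:R :> R by rewrite ltr0n.
pose K := T%:R^-1 + phi ^+ 2.
have K0 : 0 < K by rewrite ltr_pwDl ?invr_gt0 ?sqr_ge0.
have L0 : 0 < ln delta^-1 by rewrite ln_gt0// invf_gt1.
pose Gp := Gc / gamma `^ k^-1.
have Gp0 : 0 < Gp by rewrite divr_gt0 ?powR_gt0.
(* Thus the Markov threshold is exactly the [k]-th power of [Gp]. *)
have Gpk : Gp `^ k = Gc `^ k / gamma.
  rewrite /Gp powRM ?(ltW Gc0) ?invr_ge0 ?powR_ge0//; congr (_ * _).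
  rewrite -(powR_inv1 (powR_ge0 _ _)) -!powRrM mulN1r mulrN mulVf//.
  by rewrite powR_inv1// ltW.
have tauE : tau = Gp * K `^ (- (k + 1)^-1) by [].
have tau0 : 0 < tau by rewrite tauE mulr_gt0 ?powR_gt0.
have [KN Kr2 Ky Ky2 Kz] := powR_scaling_split K0 k1.
pose r := K `^ 2^-1.
pose y := K `^ (2^-1 * (1 - 2 / (k + 1))).
have r0 : 0 < r by exact: powR_gt0.
have y0 : 0 < y by exact: powR_gt0.
have try : tau * r = Gp * y by rewrite tauE -mulrA Ky.
have etaE : eta = C / (T%:R * tau) * r^-1 by rewrite /r -KN.
have eta0 : 0 < eta by rewrite etaE; apply: divr_gt0 => //; apply: divr_gt0 => //; exact: mulr_gt0.
have s20 : 0 < sigma2.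
  apply: divr_gt0; last by apply: mulr_gt0; exact: exprn_gt0.
  by apply: mulr_gt0; [do 2 apply: mulr_gt0 => //|exact: exprn_gt0].
(* The total noise variance is what [phi] is designed to measure. *)
have ds2 : d%:R * sigma2 = T%:R * tau ^+ 2 * phi ^+ 2.
  rewrite /phi expr_div_n sqr_sqrtr; last by rewrite !mulr_ge0 ?(ltW nu0) ?(ltW L0).
  by rewrite /sigma2; field; rewrite !gt_eqF.
have VV : 2 * tau ^+ 2 + d%:R * sigma2 <= 2 * tau ^+ 2 * (T%:R * r ^+ 2).
  rewrite Kr2 ds2 /K.
  have -> : 2 * tau ^+ 2 * (T%:R * (T%:R^-1 + phi ^+ 2)) =
    2 * tau ^+ 2 + T%:R * tau ^+ 2 * phi ^+ 2 + T%:R * tau ^+ 2 * phi ^+ 2.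
    by field; rewrite gt_eqF.
  rewrite lerDl; apply: mulr_ge0; last exact: sqr_ge0.
  by apply: mulr_ge0; [exact: ltW|exact: sqr_ge0].
have ss0 : 0 < Num.sqrt sigma2 by rewrite sqrtr_gt0.
have noise (t : 'I_T) j := normal_law_moments (s := Num.sqrt sigma2)
  (P := P1) (X := zeta t j) ss0 (proj1 indA (inr (t, j))) (lawz t j).
have [E [mE PE hE]] := empirical_moment_event mG aeG k1 Gc0 mom n0 (proj1 indZ) lawZ gamma0.
have main om : E om -> (OR om <= (Gp * (2^-1 * (D0 om ^+ 2 / C + 4 * C) * y
    + (D0 om + C) * y ^+ 2))%:E)%E.
  move=> /hE [hG hmom].
  (* The bound [Gp] comes from the power mean inequality, and [Gp * y ^+ 2] from the moment bound on
     the part above the clipping threshold. *)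
  pose B := Num.min Gp (Gp * y ^+ 2).
  have B0 : 0 <= B by rewrite le_min (ltW Gp0) mulr_ge0 ?sqr_ge0 ?(ltW Gp0).
  have BG : B <= Gp by rewrite ge_min lexx.
  have BGy : B <= Gp * y ^+ 2 by rewrite ge_min lexx orbT.
  have [hV bound] := dpsgd_tuning Gp0 tau0 r0 y0 T0' C0 (enorm_ge0 (w0 - wstar om))
    B0 try BG BGy VV.
  rewrite -etaE in hV bound.
  have hB v : n%:R^-1 * (\sum_(i < n)
      enorm (grad (fun v => loss v (Z i om)) v -
        clip (grad (fun v => loss v (Z i om)) v) tau)) <= B.
    rewrite le_min; apply/andP; split.
      apply: (@le_trans _ _ (n%:R^-1 * \sum_(i < n) Gf (Z i om))).
        rewrite ler_wpM2l ?invr_ge0//; apply: ler_sum => i _.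
        exact: le_trans (enorm_sub_clip_le _ tau0) (hG i v).
      by apply: (mean_le_of_powR_mean n0 k1 Gp0) => //; rewrite Gpk.
    apply: (@le_trans _ _ (n%:R^-1 *
        \sum_(i < n) Gf (Z i om) `^ k * tau `^ (1 - k))).
      rewrite ler_wpM2l ?invr_ge0//; apply: ler_sum => i _.
      exact: enorm_sub_clip_powR.
    rewrite -mulr_suml mulrA.
    apply: (@le_trans _ _ (Gp `^ k * tau `^ (1 - k))).
      by rewrite Gpk ler_wpM2r ?powR_ge0.
    (* Here [Gp^k Gp^(1-k) = Gp], and the power of [K] is [(k - 1) / (k + 1) = 1 - 2 / (k + 1)]. *)
    rewrite tauE powRM ?(ltW Gp0) ?powR_ge0// Kz -Ky2 mulrA -powRD; last first.
      by rewrite (gt_eqF Gp0) implybT.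
    by rewrite subrKC powRr1 ?(ltW Gp0).
  have := @dpsgd_risk R d n T (fun i v => loss v (Z i om)) (fun i => Gf (Z i om))
    w0 (wstar om) eta b tau sigma2 B C _ _ P1 A zeta.
  move=> /(_ (fun i v => dl (Z i om) v) hG (cf om) (fmin om) n0 T0 b1 tau0 eta0
    (ltW C0) (ltW s20) hB indA pA) risk.
  apply: le_trans (risk _ _ _ hV) _.
  - by move=> t j; have [] := noise t j.
  - by move=> t j; have [] := noise t j.
  - move=> t j; have [_ _] := noise t j.
    by rewrite sqr_sqrtr// ltW.
  - by rewrite lee_fin.
split.
  exists E; split => //; split => // om /main; rewrite /y Ky2.
  exact.
move=> TE; exists E; split => //; split => // om /main.
(* If [phi] were 0, the convention [0^-1 = 0] would give [T = 0], against [1 <= T]. *)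
have phi0 : 0 < phi.
  have : phi ^+ 2 != 0 by rewrite -invr_eq0 -TE gt_eqF.
  rewrite expf_eq0/= lt_def => ->; rewrite /phi divr_ge0 ?sqrtr_ge0//.
  by rewrite mulr_ge0 ?ltW.
have KE : K = 2 * phi ^+ 2 by rewrite /K TE invrK; ring.
have [e1 e2] := powR_double_sqr phi0 k1.
rewrite /y Ky2 KE e2 [2^-1 * _ * _]mulrAC e1.
move/le_trans; apply; rewrite lee_fin le_eqVlt; apply/orP; left; apply/eqP.
by rewrite /Gp; ring.
Qed.
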